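(* Consider the germ at $0$ of a rigid hypersurface $\{\mathrm{Re}\,z_3=F(z_1,\bar z_1,z_2,\bar z_2)\}$ in $\mathbb{C}^3$ in the class $\mathfrak{C}_{2,1}$, whose graphing function $F$ satisfies: (a) $S_1=0$ and $S_{\bar 1}=0$, where $S:=\left(F_{1\bar 2}/F_{1\bar 1}\right)_1$; (b) $F=r(z_2,\bar z_2)|z_1|^2+t(z_2,\bar z_2)z_1^2+\overline{t(z_2,\bar z_2)}\,\bar z_1^2$ for some smooth functions $r$ (real-valued) and $t$ (complex-valued) of $z_2$; (c) $t_{\bar 2}=\dfrac{r^2}{2}$; (d) $r(z_2,\bar z_2)=R(z_2+\bar z_2)$ for some smooth positive function $R(x)$ of one real variable defined near the origin. Then this germ is rigidly equivalent to the germ at $0$ of a rigid hypersurface whose graphing function is rational (a rational function of $z_1,\bar z_1,z_2,\bar z_2$).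
   Context: Subscripts $1,\bar 1,2,\bar 2$ denote partial (Wirtinger) derivatives with respect to $z_1,\bar z_1,z_2,\bar z_2$. A rigid hypersurface in $\mathbb{C}^3$ is a hypersurface given by an equation $\mathrm{Re}\,z_3=F(z_1,\bar z_1,z_2,\bar z_2)$, where $F$ (the graphing function) is a smooth real-valued function; here $F$ is defined near the origin of $\mathbb{C}^2$ with $F(0)=0$, and its domain is allowed to shrink. The class $\mathfrak{C}_{2,1}$ consists of the connected 5-dimensional CR-hypersurfaces that are 2-nondegenerate and uniformly Levi degenerate of rank 1 (the Levi form has rank exactly 1 at every point). For a rigid hypersurface with $F_{1\bar 1}>0$ everywhere, membership in $\mathfrak{C}_{2,1}$ means that $F_{1\bar 1}F_{2\bar 2}-|F_{1\bar 2}|^2=0$ everywhere and that $S:=(F_{1\bar 2}/F_{1\bar 1})_1$ vanishes nowhere. Two germs of rigid hypersurfaces at $0$ are called rigidly equivalent if there exists a map of the form $$(z_1,z_2,z_3)\mapsto\bigl(f(z_1,z_2),\,g(z_1,z_2),\,a z_3+h(z_1,z_2)\bigr),\quad a\in\mathbb{R}\setminus\{0\},$$ nondegenerate at the origin (invertible differential at $0$), where $f,g,h$ are holomorphic near $0$ with $f(0)=g(0)=h(0)=0$, that maps one hypersurface germ into the other. *)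

(* Defs.v *)
From Stdlib Require Import Reals.
From Coquelicot Require Import Coquelicot.

Local Open Scope C_scope.

Notation C2 := (prod_NormedModule C_AbsRing C_NormedModule C_NormedModule).
Notation C3 := (prod_NormedModule C_AbsRing C2 C_NormedModule).

Notation near0 V P := (@locally V (@zero V) P) (only parsing).

(** Functions are total; only their germs at the origin matter, since every
    condition below is imposed on a neighbourhood of the origin only. *)

(** ** Smooth functions *)

(** The restriction of [f] to the real line through [p] in direction [v],
    for the [R]-structure underlying the complex space [V]. *)
Definition along {V : NormedModule C_AbsRing} {T : Type}
    (f : V -> T) (p v : V) (s : R) : T :=
  f (plus p (scal (RtoC s) v)).

(** [k] times continuously differentiable on the open set [U]: all iterated
    real directional derivatives up to order [k] exist and are continuous. *)
Fixpoint Ck_on {V : NormedModule C_AbsRing} (k : nat) (U : V -> Prop)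
    (f : V -> R) : Prop :=
  (forall p, U p -> continuous f p) /\
  match k with
  | O => True
  | S k' => forall v : V,
      (forall p, U p -> ex_derive (along f p v) 0%R) /\
      Ck_on k' U (fun p => Derive (along f p v) 0%R)
  end.

Definition smooth {V : NormedModule C_AbsRing} (f : V -> R) : Prop :=
  exists U : V -> Prop, open U /\ U zero /\ forall k, Ck_on k U f.

Definition smoothC {V : NormedModule C_AbsRing} (f : V -> C) : Prop :=
  smooth (fun p => Re (f p)) /\ smooth (fun p => Im (f p)).

Definition smoothR (f : R -> R) : Prop :=
  locally 0%R (fun x => forall n, ex_derive_n f n x).

(** ** Wirtinger derivatives *)

Definition dirC {V : NormedModule C_AbsRing} (v : V) (f : V -> C) (p : V) : C :=
  (Derive (along (fun q => Re (f q)) p v) 0%R,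
   Derive (along (fun q => Im (f q)) p v) 0%R).

(** If [z] is the complex coordinate along [v], then [dirC v] is d/dx and
    [dirC (i v)] is d/dy, where [z = x + i y]. *)
Definition dz {V : NormedModule C_AbsRing} (v : V) (f : V -> C) (p : V) : C :=
  (dirC v f p - Ci * dirC (scal Ci v) f p) / 2.

Definition dzbar {V : NormedModule C_AbsRing} (v : V) (f : V -> C) (p : V) : C :=
  (dirC v f p + Ci * dirC (scal Ci v) f p) / 2.

Definition e1 : C2 := (RtoC 1, RtoC 0).
Definition e2 : C2 := (RtoC 0, RtoC 1).

Definition dz1 : (C2 -> C) -> C2 -> C := dz e1.
Definition dzb1 : (C2 -> C) -> C2 -> C := dzbar e1.
Definition dz2 : (C2 -> C) -> C2 -> C := dz e2.
Definition dzb2 : (C2 -> C) -> C2 -> C := dzbar e2.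

(** d/d(zbar) for functions of a single complex variable. *)
Definition dbar : (C -> C) -> C -> C := dzbar (V := C_NormedModule) (RtoC 1).

(** ** Rigid hypersurfaces and the class C_{2,1} *)

Definition graphing_function (F : C2 -> R) : Prop :=
  smooth F /\ F zero = 0%R.

Definition rigid_hypersurface (F : C2 -> R) : C3 -> Prop :=
  fun p => Re (snd p) = F (fst p).

Definition F11b (F : C2 -> R) : C2 -> C := dzb1 (dz1 (fun p => RtoC (F p))).
Definition F12b (F : C2 -> R) : C2 -> C := dzb2 (dz1 (fun p => RtoC (F p))).
Definition F22b (F : C2 -> R) : C2 -> C := dzb2 (dz2 (fun p => RtoC (F p))).

Definition Sfun (F : C2 -> R) : C2 -> C := dz1 (fun p => F12b F p / F11b F p).

(** Membership in C_{2,1} of a rigid hypersurface with positive F_{1 1bar}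
    (which is a real function, F being real-valued and smooth). *)
Definition class_C21 (F : C2 -> R) : Prop :=
  near0 C2 (fun p =>
    (0 < Re (F11b F p))%R /\
    F11b F p * F22b F p - RtoC (Cmod (F12b F p) ^ 2) = 0 /\
    Sfun F p <> 0).

(** ** Rigid equivalence of germs *)

(** Holomorphic near the origin: complex Frechet differentiable at every point
    of a neighbourhood (the base field of [C2] is [C_AbsRing]). *)
Definition holomorphic (f : C2 -> C) : Prop :=
  near0 C2 (fun p =>
    ex_filterdiff (K := C_AbsRing) (U := C2) (V := C_NormedModule) f (locally p)).

Definition rigid_map (f g h : C2 -> C) (a : R) : C3 -> C3 :=
  fun p => ((f (fst p), g (fst p)), RtoC a * snd p + h (fst p)).

Definition nondegenerate (Phi : C3 -> C3) : Prop :=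
  exists l m : C3 -> C3,
    filterdiff (K := C_AbsRing) (U := C3) (V := C3) Phi (@locally C3 zero) l /\
    (forall p, m (l p) = p) /\ (forall p, l (m p) = p).

Definition rigidly_equivalent (F G : C2 -> R) : Prop :=
  exists (f g h : C2 -> C) (a : R),
    holomorphic f /\ holomorphic g /\ holomorphic h /\
    f zero = 0 /\ g zero = 0 /\ h zero = 0 /\
    a <> 0%R /\
    nondegenerate (rigid_map f g h a) /\
    near0 C3 (fun p =>
      rigid_hypersurface F p -> rigid_hypersurface G (rigid_map f g h a p)).

(** ** Rational graphing functions *)

(** Polynomials in the four quantities [z1, conj z1, z2, conj z2]. *)
Inductive polynomial : (C2 -> C) -> Prop :=
| poly_const (c : C) : polynomial (fun _ => c)
| poly_z1 : polynomial (fun p => fst p)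
| poly_z1b : polynomial (fun p => Cconj (fst p))
| poly_z2 : polynomial (fun p => snd p)
| poly_z2b : polynomial (fun p => Cconj (snd p))
| poly_add (P Q : C2 -> C) :
    polynomial P -> polynomial Q -> polynomial (fun p => P p + Q p)
| poly_mul (P Q : C2 -> C) :
    polynomial P -> polynomial Q -> polynomial (fun p => P p * Q p).

(** The denominator must not vanish at the origin.  For a smooth germ this
    is no restriction: after cancelling common factors it holds automatically. *)
Definition rational (G : C2 -> R) : Prop :=
  exists P Q : C2 -> C,
    polynomial P /\ polynomial Q /\ Q zero <> 0 /\
    near0 C2 (fun p => RtoC (G p) = P p / Q p).

(* Main.v *)
Require Import Defs.
From Stdlib Require Import Reals Lra Psatz.
From Coquelicot Require Import Coquelicot.

Local Open Scope C_scope.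

(** Write x = z2 + conj z2. With F = r |z1|^2 + 2 Re (t z1^2), r = R(x) and
    dt/d(conj z2) = r^2/2, Levi degeneracy along z1 = e and z1 = i e forces
    R R'' = R'^2 + R^4, that is (log R)'' = R^2 ([levi_ode]). This Liouville
    equation linearizes: k = (R'/R)^2 - R^2 is constant and w = 1/R satisfies
    w'' = k w, w'^2 - k w^2 = 1 ([liouville_reciprocal]). Thus w is a combination
    of cosine and sine type functions, has an entire extension W, and, with s the
    sine of the same equation and a = w(0), the addition formulas give
    [[
      a w(x) = |W(z2)|^2 - |s(z2)|^2,    W'(z2) w(x) - w'(x) W(z2) = conj s(z2)
    ]]
    ([polarized_solution]).

    Moreover R'/(2R) = - w'/(2w) solves the equation for t, so t + w'/(2w) is a
    holomorphic function tau of z2 ([remainder_holomorphic]). Hence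
    [[
      F = |z1|^2 / w - Re (z1^2 w'/w) + 2 Re (tau z1^2),
    ]]
    and by the two identities F + Re (z1^2 (W'/W - 2 tau)) is the function
    [[
      G = (|y1|^2 + Re (y1^2 conj y2)) / (1 - |y2|^2)
    ]]
    of y1 = sqrt(a) z1 / W and y2 = s / W ([lightcone_pullback]). The added term
    is the real part of a holomorphic function, so it is absorbed by z3. The
    rational model G does not depend on R: it is a local form of the tube over
    the light cone.

    Holomorphy of tau, of W and of s is obtained from the Cauchy-Riemann equations
    ([is_Cderive_dbar]). W and s are combinations of an entire cosine and an entire
    sine, whose real and imaginary parts are, up to constants, products of a real
    solution for k and a real solution for -k. *)

(** * Derivatives along lines *)

(* Rules for generic normed modules leave equalities at their carrier types, over
   which [ring] and [field] are not declared. *)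
Ltac real_eq := match goal with |- @eq _ ?x ?y => change (@eq R x y) end.
Ltac complex_eq := match goal with |- @eq _ ?x ?y => change (@eq C x y) end.

Lemma minus_plus_l {G : AbelianGroup} (p x : G) : minus (plus p x) p = x.
Proof.
unfold minus; rewrite (plus_comm p), <- plus_assoc.
change (plus x (minus p p) = x); rewrite minus_eq_zero; apply plus_zero_r.
Qed.

(** Restricting to a line keeps neighbourhoods; hence derivatives along a line
    depend only on germs, and local identities may be differentiated. *)
Lemma locally_along {V : NormedModule C_AbsRing} (P : V -> Prop) (p v : V) :
  locally p P -> locally 0%R (fun s : R => P (plus p (scal (RtoC s) v))).
Proof.
intros HP.
apply (locally_norm_le_locally p) in HP.
destruct HP as [e He].
assert (Hn : (0 < norm v + 1)%R) by (generalize (norm_ge_0 v); lra).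
exists (mkposreal (e / (norm v + 1)) (Rdiv_lt_0_compat _ _ (cond_pos e) Hn)).
intros s Hs; apply He; unfold ball_norm.
replace (minus (plus p (scal (RtoC s) v)) p) with (scal (RtoC s) v).
2: { exact (eq_sym (minus_plus_l (G := NormedModule.AbelianGroup _ V) p _)). }
eapply Rle_lt_trans; [apply @norm_scal|].
change (abs (RtoC s)) with (Cmod (RtoC s)); rewrite Cmod_R.
change (Rabs (s - 0) < e / (norm v + 1))%R in Hs; rewrite Rminus_0_r in Hs.
apply Rle_lt_trans with (Rabs s * (norm v + 1))%R.
- apply Rmult_le_compat_l; [apply Rabs_pos|lra].
- apply Rlt_le_trans with (e / (norm v + 1) * (norm v + 1))%R.
  + apply Rmult_lt_compat_r; assumption.
  + right; field; lra.
Qed.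

Lemma along_0 {V : NormedModule C_AbsRing} {T} (f : V -> T) (p v : V) :
  along f p v 0 = f p.
Proof.
unfold along; f_equal.
exact (eq_trans (f_equal (plus p) (scal_zero_l v)) (plus_zero_r p)).
Qed.

Lemma along_ext {V : NormedModule C_AbsRing} (f g : V -> R) (p v : V) l :
  locally p (fun q => f q = g q) ->
  is_derive (along g p v) 0%R l -> is_derive (along f p v) 0%R l.
Proof.
intros H; apply is_derive_ext_loc.
generalize (locally_along _ p v H); apply filter_imp; intros s Hs; symmetry; exact Hs.
Qed.

Lemma Derive_along_ext {V : NormedModule C_AbsRing} (f g : V -> R) (p v : V) :
  locally p (fun q => f q = g q) ->
  Derive (along f p v) 0%R = Derive (along g p v) 0%R.
Proof.
intros H; apply Derive_ext_loc, (locally_along _ p v H).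
Qed.

Lemma dirC_ext {V : NormedModule C_AbsRing} (f g : V -> C) (p v : V) :
  locally p (fun q => f q = g q) -> dirC v f p = dirC v g p.
Proof.
intros H; unfold dirC; f_equal; apply Derive_along_ext;
  revert H; apply filter_imp; intros q Hq; rewrite Hq; reflexivity.
Qed.

Lemma dirC_eq {V : NormedModule C_AbsRing} (f : V -> C) (p v : V) (a b : R) :
  is_derive (along (fun q => Re (f q)) p v) 0%R a ->
  is_derive (along (fun q => Im (f q)) p v) 0%R b ->
  dirC v f p = (a, b).
Proof.
intros Ha Hb; unfold dirC; f_equal; apply is_derive_unique; assumption.
Qed.

Lemma dz_eq {V : NormedModule C_AbsRing} (f : V -> C) (p v : V) (a b a' b' : R) :
  is_derive (along (fun q => Re (f q)) p v) 0%R a ->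
  is_derive (along (fun q => Im (f q)) p v) 0%R b ->
  is_derive (along (fun q => Re (f q)) p (scal Ci v)) 0%R a' ->
  is_derive (along (fun q => Im (f q)) p (scal Ci v)) 0%R b' ->
  dz v f p = ((a + b') / 2, (b - a') / 2)%R /\
  dzbar v f p = ((a - b') / 2, (b + a') / 2)%R.
Proof.
intros H1 H2 H3 H4; unfold dz, dzbar.
rewrite (dirC_eq f p v a b), (dirC_eq f p (scal Ci v) a' b') by assumption.
split; unfold Cdiv, Cminus, Cplus, Copp, Cmult, Cinv, Ci, RtoC; simpl; f_equal; field.
Qed.

Lemma dzbar_ext {V : NormedModule C_AbsRing} (f g : V -> C) (p v : V) :
  locally p (fun q => f q = g q) -> dzbar v f p = dzbar v g p.
Proof.
intros H; unfold dzbar; rewrite 2!(dirC_ext f g p _ H); reflexivity.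
Qed.

(** [Derive] being total, this formula and the next two need no differentiability.
    Used on second derivatives, they avoid any appeal to the mixed ones. *)
Lemma dz_real {V : NormedModule C_AbsRing} (f : V -> R) (p v : V) :
  dz v (fun q => RtoC (f q)) p =
  (Derive (along f p v) 0 / 2, - Derive (along f p (scal Ci v)) 0 / 2)%R.
Proof.
assert (H : forall w, dirC w (fun q => RtoC (f q)) p = (Derive (along f p w) 0, 0)%R).
{ intros w; unfold dirC; f_equal; exact (Derive_const 0 0). }
unfold dz; rewrite 2!H.
apply injective_projections; simpl; field.
Qed.

Lemma Re_dzbar {V : NormedModule C_AbsRing} (f : V -> C) (p v : V) :
  Re (dzbar v f p) =
  ((Derive (along (fun q => Re (f q)) p v) 0
    - Derive (along (fun q => Im (f q)) p (scal Ci v)) 0) / 2)%R.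
Proof.
unfold dzbar, dirC, Cdiv, Cminus, Cplus, Copp, Cmult, Cinv, Ci, RtoC; simpl; field.
Qed.

Lemma Im_dzbar {V : NormedModule C_AbsRing} (f : V -> C) (p v : V) :
  Im (dzbar v f p) =
  ((Derive (along (fun q => Im (f q)) p v) 0
    + Derive (along (fun q => Re (f q)) p (scal Ci v)) 0) / 2)%R.
Proof.
unfold dzbar, dirC, Cdiv, Cminus, Cplus, Copp, Cmult, Cinv, Ci, RtoC; simpl; field.
Qed.

(** * The Levi form of a quadratic graphing function *)

Local Open Scope R_scope.

Definition px (u : C -> R) (z : C) : R :=
  Derive (along (V := C_NormedModule) u z (RtoC 1)) 0.
Definition py (u : C -> R) (z : C) : R :=
  Derive (along (V := C_NormedModule) u z (scal Ci (RtoC 1))) 0.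

Lemma shift_x (z : C) (s : R) :
  @plus C_NormedModule z (scal (RtoC s) (RtoC 1)) = (Re z + s, Im z).
Proof.
change (Cplus z (Cmult (RtoC s) (RtoC 1)) = (Re z + s, Im z)).
apply injective_projections; simpl; unfold Re, Im; ring.
Qed.

Lemma shift_y (z : C) (s : R) :
  @plus C_NormedModule z (scal (RtoC s) (scal Ci (RtoC 1))) = (Re z, Im z + s).
Proof.
change (Cplus z (Cmult (RtoC s) (Cmult Ci (RtoC 1))) = (Re z, Im z + s)).
apply injective_projections; simpl; unfold Re, Im; ring.
Qed.

Lemma shift_e1 (p : C2) (s : R) :
  plus p (scal (RtoC s) e1) = ((Re (fst p) + s, Im (fst p)), snd p).
Proof.
apply injective_projections; [exact (shift_x (fst p) s)|].
change (Cplus (snd p) (Cmult (RtoC s) (RtoC 0)) = snd p); ring.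
Qed.

Lemma shift_ie1 (p : C2) (s : R) :
  plus p (scal (RtoC s) (scal Ci e1)) = ((Re (fst p), Im (fst p) + s), snd p).
Proof.
apply injective_projections; [exact (shift_y (fst p) s)|].
change (Cplus (snd p) (Cmult (RtoC s) (Cmult Ci (RtoC 0))) = snd p); ring.
Qed.

Lemma shift_e2 (p : C2) (s : R) :
  plus p (scal (RtoC s) e2) =
  (fst p, (Re (snd p) + s, Im (snd p))).
Proof.
apply injective_projections; [|exact (shift_x (snd p) s)].
change (Cplus (fst p) (Cmult (RtoC s) (RtoC 0)) = fst p); ring.
Qed.

Lemma shift_ie2 (p : C2) (s : R) :
  plus p (scal (RtoC s) (scal Ci e2)) =
  (fst p, (Re (snd p), Im (snd p) + s)).
Proof.
apply injective_projections; [|exact (shift_y (snd p) s)].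
change (Cplus (fst p) (Cmult (RtoC s) (Cmult Ci (RtoC 0))) = fst p); ring.
Qed.

Lemma is_derive_comb (f g h : R -> R) (a b c : R) :
  ex_derive f 0 -> ex_derive g 0 -> ex_derive h 0 ->
  is_derive (fun s => a * f s + b * g s + c * h s) 0
    (a * Derive f 0 + b * Derive g 0 + c * Derive h 0).
Proof.
intros Hf Hg Hh; apply Derive_correct in Hf, Hg, Hh.
apply (is_derive_plus (fun s => a * f s + b * g s) (fun s => c * h s));
  [apply (is_derive_plus (fun s => a * f s) (fun s => b * g s))|];
  apply @is_derive_scal; assumption.
Qed.

Definition ex_px_py (w : C -> R) (z : C) : Prop :=
  ex_derive (along (V := C_NormedModule) w z (RtoC 1)) 0 /\
  ex_derive (along (V := C_NormedModule) w z (scal Ci (RtoC 1))) 0.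

Definition second_order (w : C -> R) (z : C) : Prop :=
  locally z (ex_px_py w) /\
     ex_derive (along (V := C_NormedModule) (px w) z (RtoC 1)) 0 /\
     ex_derive (along (V := C_NormedModule) (py w) z (scal Ci (RtoC 1))) 0.

Section Quadratic.
Context (F : C2 -> R) (r u v : C -> R).

(** With [t = u + i v], this is r |z1|^2 + t z1^2 + conj(t z1^2). *)
Definition quadratic_form (p : C2) : R :=
  r (snd p) * (Re (fst p) ^ 2 + Im (fst p) ^ 2)
        + 2 * (u (snd p) * (Re (fst p) ^ 2 - Im (fst p) ^ 2)
               - 2 * v (snd p) * (Re (fst p) * Im (fst p))).

Definition is_quadratic (p : C2) : Prop := F p = quadratic_form p.

Lemma dz1_quadratic (p : C2) :
  locally p is_quadratic ->
  dz1 (fun q => RtoC (F q)) p =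
  (r (snd p) * Re (fst p) + 2 * (u (snd p) * Re (fst p) - v (snd p) * Im (fst p)),
   - r (snd p) * Im (fst p) + 2 * (u (snd p) * Im (fst p) + v (snd p) * Re (fst p))).
Proof.
intros H; destruct p as [[a0 b0] z2].
set (p := (((a0, b0), z2) : C2)) in *.
destruct (dz_eq (fun q => RtoC (F q)) p e1
  (2 * r (snd p) * Re (fst p) + 4 * (u (snd p) * Re (fst p) - v (snd p) * Im (fst p))) 0
  (2 * r (snd p) * Im (fst p) - 4 * (u (snd p) * Im (fst p) + v (snd p) * Re (fst p))) 0) as [E _].
- eapply along_ext; [exact H|].
  apply is_derive_ext with (f := fun s => let a := Re (fst p) + s in let b := Im (fst p) in
    r (snd p) * (a ^ 2 + b ^ 2) + 2 * (u (snd p) * (a ^ 2 - b ^ 2) - 2 * v (snd p) * (a * b))).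
  { intros s; unfold along; rewrite shift_e1; reflexivity. }
  cbv zeta; auto_derive; [exact I|real_eq; unfold Re, Im; simpl; ring].
- exact (is_derive_const (K := R_AbsRing) (V := R_NormedModule) 0 0).
- eapply along_ext; [exact H|].
  apply is_derive_ext with (f := fun s => let a := Re (fst p) in let b := Im (fst p) + s in
    r (snd p) * (a ^ 2 + b ^ 2) + 2 * (u (snd p) * (a ^ 2 - b ^ 2) - 2 * v (snd p) * (a * b))).
  { intros s; unfold along; rewrite shift_ie1; reflexivity. }
  cbv zeta; auto_derive; [exact I|real_eq; unfold Re, Im; simpl; ring].
- exact (is_derive_const (K := R_AbsRing) (V := R_NormedModule) 0 0).
- apply (eq_trans E); unfold p; apply injective_projections; simpl; field.
Qed.

Lemma F11b_quadratic (p : C2) :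
  locally p is_quadratic -> F11b F p = RtoC (r (snd p)).
Proof.
intros H; apply locally_locally in H; destruct p as [[a0 b0] z2].
unfold F11b, dzb1.
set (p := (((a0, b0), z2) : C2)) in *.
set (L := fun q : C2 => 
  (r (snd q) * Re (fst q) + 2 * (u (snd q) * Re (fst q) - v (snd q) * Im (fst q)),
   - r (snd q) * Im (fst q) + 2 * (u (snd q) * Im (fst q) + v (snd q) * Re (fst q))) : C).
assert (HL : locally p (fun q => dz1 (fun q => RtoC (F q)) q = L q)).
{ revert H; apply filter_imp; intros q; apply dz1_quadratic. }
destruct (dz_eq L p e1
  (r (snd p) + 2 * u (snd p)) (2 * v (snd p)) (- 2 * v (snd p)) (- r (snd p) + 2 * u (snd p))) as [_ E].
1-4: unfold along; eapply is_derive_ext;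
  [intros s; rewrite ?shift_e1, ?shift_ie1; reflexivity|];
  simpl; auto_derive; [exact I|real_eq; unfold Re, Im; simpl; ring].
apply (eq_trans (dzbar_ext _ _ p _ HL)), (eq_trans E); apply injective_projections; simpl; field.
Qed.

Lemma F12b_quadratic (p : C2) :
  locally p is_quadratic ->
  ex_px_py r (snd p) -> ex_px_py u (snd p) -> ex_px_py v (snd p) ->
  F12b F p =
  (((px r (snd p) * Re (fst p) + 2 * (px u (snd p) * Re (fst p) - px v (snd p) * Im (fst p)))
    - (- py r (snd p) * Im (fst p) + 2 * (py u (snd p) * Im (fst p) + py v (snd p) * Re (fst p)))) / 2,
   ((- px r (snd p) * Im (fst p) + 2 * (px u (snd p) * Im (fst p) + px v (snd p) * Re (fst p)))
    + (py r (snd p) * Re (fst p) + 2 * (py u (snd p) * Re (fst p) - py v (snd p) * Im (fst p)))) / 2).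
Proof.
intros H [r1 r2] [u1 u2] [v1 v2].
apply locally_locally in H; destruct p as [[a0 b0] z2].
simpl in r1, r2, u1, u2, v1, v2.
unfold F12b, dzb2.
set (p := (((a0, b0), z2) : C2)) in *.
set (L := fun q : C2 => 
  (r (snd q) * Re (fst q) + 2 * (u (snd q) * Re (fst q) - v (snd q) * Im (fst q)),
   - r (snd q) * Im (fst q) + 2 * (u (snd q) * Im (fst q) + v (snd q) * Re (fst q))) : C).
assert (HL : locally p (fun q => dz1 (fun q => RtoC (F q)) q = L q)).
{ revert H; apply filter_imp; intros q; apply dz1_quadratic. }
apply (eq_trans (dzbar_ext _ _ p _ HL)).
destruct (dz_eq L p e2
  (a0 * px r z2 + 2 * a0 * px u z2 + -2 * b0 * px v z2)
  (- b0 * px r z2 + 2 * b0 * px u z2 + 2 * a0 * px v z2)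
  (a0 * py r z2 + 2 * a0 * py u z2 + -2 * b0 * py v z2)
  (- b0 * py r z2 + 2 * b0 * py u z2 + 2 * a0 * py v z2)) as [_ E].
1-4: eapply is_derive_ext; [|apply is_derive_comb; assumption];
  intros s; unfold along; rewrite ?shift_e2, ?shift_ie2, ?shift_x, ?shift_y;
  unfold L, Re, Im; cbn [fst snd p]; real_eq; ring.
apply (eq_trans E); apply injective_projections; simpl; unfold Re, Im; simpl; field.
Qed.

(** The real part involves only the pure second derivatives, and the degeneracy
    equation needs no more, its other terms being real. *)
Lemma Re_F22b_quadratic (p : C2) :
  locally p is_quadratic ->
  (forall w, w = r \/ w = u \/ w = v -> second_order w (snd p)) ->
  Re (F22b F p) =
  ((Re (fst p) ^ 2 + Im (fst p) ^ 2) * (px (px r) (snd p) + py (py r) (snd p))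
   + 2 * (Re (fst p) ^ 2 - Im (fst p) ^ 2) * (px (px u) (snd p) + py (py u) (snd p))
   - 4 * (Re (fst p) * Im (fst p)) * (px (px v) (snd p) + py (py v) (snd p))) / 4.
Proof.
intros H Hw.
destruct (Hw r) as (r0 & r1 & r2); [tauto|].
destruct (Hw u) as (u0 & u1 & u2); [tauto|].
destruct (Hw v) as (v0 & v1 & v2); [tauto|].
clear Hw; apply locally_locally in H.
assert (Hsnd : forall P : C -> Prop, locally (snd p) P -> locally p (fun q => P (snd q))).
{ intros P [e He]; exists e; intros q [_ Hq]; exact (He _ Hq). }
apply Hsnd in r0; apply Hsnd in u0; apply Hsnd in v0; clear Hsnd.
set (m := fun q : C2 => Re (fst q) ^ 2 + Im (fst q) ^ 2).
set (a := fun q : C2 => 2 * (Re (fst q) ^ 2 - Im (fst q) ^ 2)).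
set (b := fun q : C2 => -4 * (Re (fst q) * Im (fst q))).
set (L := fun q : C2 => 
  ((m q * px r (snd q) + a q * px u (snd q) + b q * px v (snd q)) / 2,
   - (m q * py r (snd q) + a q * py u (snd q) + b q * py v (snd q)) / 2) : C).
assert (HL : locally p (fun q => dz2 (fun q => RtoC (F q)) q = L q)).
{ generalize (filter_and _ _ H (filter_and _ _ r0 (filter_and _ _ u0 v0))).
  apply filter_imp; intros [[qa qb] z2] (Hq & [r3 r4] & [u3 u4] & [v3 v4]).
  apply (eq_trans (dz_real F _ e2)); unfold L.
  apply injective_projections; simpl; do 2 f_equal;
    rewrite (Derive_along_ext F quadratic_form _ _ Hq); apply is_derive_unique;
    (eapply is_derive_ext; [|apply is_derive_comb; eassumption]);
    intros s; unfold along; rewrite ?shift_e2, ?shift_ie2, ?shift_x, ?shift_y;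
    unfold quadratic_form, m, a, b, Re, Im; cbn [fst snd]; real_eq; ring. }
apply (eq_trans (f_equal Re (dzbar_ext _ _ p e2 HL))).
rewrite Re_dzbar.
destruct p as [[a0 b0] z2]; cbn [fst snd] in *.
set (m0 := a0 ^ 2 + b0 ^ 2); set (m1 := a0 ^ 2 - b0 ^ 2); set (m2 := a0 * b0).
assert (E1 : is_derive (along (fun q => Re (L q)) (((a0, b0), z2) : C2) e2) 0
  (m0 / 2 * px (px r) z2 + m1 * px (px u) z2 + - 2 * m2 * px (px v) z2)).
{ eapply is_derive_ext; [|apply is_derive_comb; eassumption].
  intros s; unfold along; rewrite ?shift_e2, ?shift_x; unfold L, m, a, b, m0, m1, m2, Re, Im.
  cbn [fst snd]; real_eq; field. }
assert (E2 : is_derive (along (fun q => Im (L q)) (((a0, b0), z2) : C2) (scal Ci e2)) 0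
  (- m0 / 2 * py (py r) z2 + - m1 * py (py u) z2 + 2 * m2 * py (py v) z2)).
{ eapply is_derive_ext; [|apply is_derive_comb; eassumption].
  intros s; unfold along; rewrite ?shift_ie2, ?shift_y; unfold L, m, a, b, m0, m1, m2, Re, Im.
  cbn [fst snd]; real_eq; field. }
apply (eq_trans (f_equal2 (fun x y => (x - y) / 2)
  (is_derive_unique _ _ _ E1) (is_derive_unique _ _ _ E2))).
unfold m0, m1, m2, Re, Im; cbn [fst snd]; field.
Qed.
End Quadratic.

(** Adding the degeneracy equations at z1 = e and z1 = i e kills every term
    carrying z1^2 or its conjugate: the second derivatives of [t], on which nothing
    is known beforehand, drop out, and an equation for [r] alone remains. *)
Lemma levi_degeneracy_average (F : C2 -> R) (r u v : C -> R) (e : R) (z : C) :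
  e <> 0 ->
  (forall z1 : C, z1 = (e, 0) \/ z1 = (0, e) ->
     locally ((z1, z) : C2) (is_quadratic F r u v) /\
     (F11b F (z1, z) * F22b F (z1, z) - RtoC (Cmod (F12b F (z1, z)) ^ 2) = 0)%C) ->
  (forall w, w = r \/ w = u \/ w = v -> second_order w z) ->
  px u z - py v z = r z ^ 2 -> px v z + py u z = 0 ->
  r z * (px (px r) z + py (py r) z) = px r z ^ 2 + py r z ^ 2 + 4 * r z ^ 4.
Proof.
intros He H Hw Hu Hv.
destruct (H (e, 0)) as [Q1 L1]; [tauto|].
destruct (H (0, e)) as [Q2 L2]; [tauto|].
clear H.
assert (Hex : forall w, w = r \/ w = u \/ w = v -> ex_px_py w z).
{ intros w W; apply (locally_singleton _ _ (proj1 (Hw w W))). }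
assert (HL : forall z1 : C, locally ((z1, z) : C2) (is_quadratic F r u v) ->
  (F11b F (z1, z) * F22b F (z1, z) - RtoC (Cmod (F12b F (z1, z)) ^ 2) = 0)%C ->
  r z * Re (F22b F (z1, z)) = Re (F12b F (z1, z)) ^ 2 + Im (F12b F (z1, z)) ^ 2).
{ intros z1 Q1' L1'; apply (f_equal Re) in L1'.
  rewrite (F11b_quadratic F r u v _ Q1'), Cmod2_alt in L1'.
  revert L1'; generalize (F22b F (z1, z)) (F12b F (z1, z)).
  unfold Re, Im; simpl; intros; nra. }
generalize (HL _ Q1 L1) (HL _ Q2 L2).
rewrite 2!(Re_F22b_quadratic F r u v) by assumption.
rewrite 2!(F12b_quadratic F r u v) by (try assumption; apply Hex; tauto).
cbn [fst snd Re Im]; unfold Re, Im; cbn [fst snd].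
generalize (px (px r) z) (py (py r) z) (px (px u) z) (py (py u) z)
   (px (px v) z) (py (py v) z).
intros rxx ryy uxx uyy vxx vyy E1 E2.
replace (px u z) with (r z ^ 2 + py v z) in * by lra.
replace (px v z) with (- py u z) in * by lra.
apply Rmult_eq_reg_l with (e ^ 2); [|apply pow_nonzero; assumption].
nra.
Qed.

Lemma smooth_second_order (w : C -> R) :
  smooth (V := C_NormedModule) w ->
  locally (T := C_UniformSpace) (RtoC 0) (second_order w).
Proof.
intros (U & oU & U0 & HU).
generalize (oU _ U0); apply filter_imp; intros z Uz.
destruct (HU 2%nat) as [_ H2].
split; [|split].
- apply (locally_open U); [exact oU| |exact Uz].
  intros q Uq; split; apply (proj1 (H2 _) q Uq).
- exact (proj1 (proj2 (proj2 (H2 (RtoC 1))) (RtoC 1)) z Uz).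
- exact (proj1 (proj2 (proj2 (H2 (scal Ci (RtoC 1)))) (scal Ci (RtoC 1))) z Uz).
Qed.

Lemma ball_Re_Im (e : R) (z : C) :
  Rabs (Re z) < e -> Rabs (Im z) < e -> ball (M := C_UniformSpace) (RtoC 0) e z.
Proof.
intros H1 H2; split.
- change (Rabs (Re z - 0) < e); rewrite Rminus_0_r; exact H1.
- change (Rabs (Im z - 0) < e); rewrite Rminus_0_r; exact H2.
Qed.

Section Tube.
Context (r : C -> R) (f : R -> R).

(** [r] is the pull-back of [f] under z -> z + conj z. *)
Definition tube (z : C) : Prop := r z = f (2 * Re z).

Lemma tube_along_x (z : C) l :
  locally (T := C_UniformSpace) z tube -> is_derive f (2 * Re z) l ->
  is_derive (along (V := C_NormedModule) r z (RtoC 1)) 0 (2 * l).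
Proof.
intros H Hf.
apply (along_ext (V := C_NormedModule) r (fun z => f (2 * Re z)) z (RtoC 1) _ H).
apply is_derive_ext with (f := fun s => f (2 * (Re z + s))).
{ intros s; unfold along; rewrite shift_x; reflexivity. }
apply (is_derive_comp f (fun s => 2 * (Re z + s))).
- rewrite Rplus_0_r; exact Hf.
- auto_derive; [exact I|ring].
Qed.

Lemma tube_along_y (z : C) :
  locally (T := C_UniformSpace) z tube ->
  is_derive (along (V := C_NormedModule) r z (scal Ci (RtoC 1))) 0 0.
Proof.
intros H.
apply (along_ext (V := C_NormedModule) r (fun z => f (2 * Re z)) z _ _ H).
apply is_derive_ext with (f := fun s => f (2 * Re z)).
{ intros s; unfold along; rewrite shift_y; reflexivity. }
exact (is_derive_const (K := R_AbsRing) (V := R_NormedModule) _ _).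
Qed.

End Tube.

Lemma locally_tube (P : R -> Prop) :
  locally 0 P -> locally (T := C_UniformSpace) (RtoC 0) (fun z => P (2 * Re z)).
Proof.
intros [e He].
assert (He2 : 0 < e / 2) by (generalize (cond_pos e); lra).
exists (mkposreal _ He2); intros z [Hz _]; apply He.
change (Rabs (2 * Re z - 0) < e).
change (Rabs (Re z - 0) < e / 2) in Hz.
rewrite Rminus_0_r in *; rewrite Rabs_mult, (Rabs_pos_eq 2); lra.
Qed.

(** On functions of z2 + conj z2 the operators d/dz2 and d/d(conj z2) are both
    d/dx, so the averaged degeneracy equation reads off at real z2 = x/2. *)
Lemma levi_ode (F : C2 -> R) (r : C -> R) (t : C -> C) (f : R -> R) :
  near0 C2 (fun p =>
    F11b F p * F22b F p - RtoC (Cmod (F12b F p) ^ 2) = 0)%C ->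
  near0 C2 (fun p =>
     RtoC (F p) = RtoC (r (snd p)) * RtoC (Cmod (fst p) ^ 2)
                  + t (snd p) * fst p ^ 2
                  + Cconj (t (snd p)) * Cconj (fst p) ^ 2)%C ->
  smooth (V := C_NormedModule) r -> smoothC (V := C_NormedModule) t ->
  near0 C_NormedModule (fun z => dbar t z = RtoC (r z) ^ 2 / 2)%C ->
  smoothR f -> 
  near0 C_NormedModule (tube r f) ->
  locally 0 (fun x => f x * Derive (Derive f) x = Derive f x ^ 2 + f x ^ 4).
Proof.
intros HL HF Hr [Hu Hv] Ht Hf Htube; unfold smoothR in Hf.
apply smooth_second_order in Hr, Hu, Hv.
assert (HQ : near0 C2 (is_quadratic F r (fun z => Re (t z)) (fun z => Im (t z)))).
{ revert HF; apply filter_imp; intros [[a b] z2] E; apply (f_equal Re) in E.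
  unfold is_quadratic, quadratic_form; rewrite Cmod2_alt in E; revert E.
  cbn [fst snd]; destruct (t z2) as [t1 t2].
  unfold Re, Im, Cconj, RtoC, Cplus, Cmult; simpl; intros E; rewrite E; ring. }
apply locally_locally in HQ.
assert (Hf1 : near0 C_NormedModule (fun z => ex_derive f (2 * Re z))).
{ refine (locally_tube _ _); revert Hf; apply filter_imp; intros x Hx; exact (Hx 1%nat). }
assert (Hpx : near0 C_NormedModule (fun z => tube (px r) (fun x => 2 * Derive f x) z /\ py r z = 0)).
{ apply locally_locally in Htube.
  generalize (filter_and _ _ Htube Hf1); apply filter_imp; intros z [T D]; split.
  - apply is_derive_unique, (tube_along_x r f); [exact T|apply Derive_correct, D].
  - apply is_derive_unique, (tube_along_y r f), T. }
assert (Hx : near0 C_NormedModule (fun z => px r z = 2 * Derive f (2 * Re z) /\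
     py r z = 0 /\ px (px r) z = 4 * Derive (Derive f) (2 * Re z) /\ py (py r) z = 0)).
{ apply locally_locally in Hpx.
  assert (Hf2 : near0 C_NormedModule (fun z => ex_derive (Derive f) (2 * Re z))).
  { refine (locally_tube _ _); revert Hf; apply filter_imp; intros x Hx; exact (Hx 2%nat). }
  generalize (filter_and _ _ Hpx Hf2); apply filter_imp; intros z [T D].
  destruct (locally_singleton _ _ T) as [T1 T2].
  repeat split; try assumption.
  - replace (4 * Derive (Derive f) (2 * Re z)) with (2 * (2 * Derive (Derive f) (2 * Re z))) by ring.
    apply is_derive_unique, (tube_along_x _ (fun x => 2 * Derive f x)).
    + revert T; apply filter_imp; tauto.
    + apply (is_derive_scal (Derive f)), Derive_correct, D.
  - apply is_derive_unique, (tube_along_y _ (fun x => 0)).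
    revert T; apply filter_imp; intros z' [_ T']; exact T'. }
destruct (filter_and _ _ HL HQ) as [e He].
destruct (filter_and _ _ Hx (filter_and _ _ Htube (filter_and _ _ Ht (filter_and _ _ Hr (filter_and _ _ Hu Hv))))) as [d Hdd].
(* The test points are (m/2, x/2) and (i m/2, x/2). *)
set (m := Rmin e d).
assert (Hm : 0 < m) by (apply Rmin_pos; apply cond_pos).
assert (Hme : m <= e) by apply Rmin_l.
assert (Hmd : m <= d) by apply Rmin_r.
exists (mkposreal m Hm); intros x Hx0.
change (Rabs (x - 0) < m) in Hx0; rewrite Rminus_0_r in Hx0.
set (z := (x / 2, 0) : C).
assert (Hz : ball (M := C_UniformSpace) (RtoC 0) m z).
{ apply ball_Re_Im; unfold z, Re, Im; cbn [fst snd].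
  - unfold Rdiv; rewrite Rabs_mult, (Rabs_pos_eq (/ 2)); generalize (Rabs_pos x); lra.
  - rewrite Rabs_R0; exact Hm. }
destruct (Hdd z (ball_le _ _ _ Hmd _ Hz)) as (E & T & Tt & W1 & W2 & W3).
assert (L := levi_degeneracy_average F r (fun z => Re (t z)) (fun z => Im (t z)) (m / 2) z).
assert (Ht1 := f_equal Re Tt); assert (Ht2 := f_equal Im Tt).
unfold dbar in Ht1, Ht2; rewrite Re_dzbar in Ht1; rewrite Im_dzbar in Ht2.
destruct E as (E1 & E2 & E3 & E4).
rewrite E1, E2, E3, E4, T in L.
replace (2 * Re z) with x in L by (change (x = 2 * (x / 2)); lra).
apply Rmult_eq_reg_l with 4; [|lra].
transitivity (f x * (4 * Derive (Derive f) x + 0)); [ring|].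
rewrite L; [ring|lra|..].
- intros z1 Hz1.
  assert (Hb : ball (M := C_UniformSpace) (RtoC 0) m z1).
  { destruct Hz1 as [-> | ->]; apply ball_Re_Im; unfold Re, Im; cbn [fst snd];
      rewrite ?Rabs_R0; rewrite ?(Rabs_pos_eq (m / 2)); lra. }
  apply and_comm, (He (z1, z)).
  exact (conj (ball_le _ _ _ Hme _ Hb) (ball_le _ _ _ Hme _ Hz)).
- intros w [-> |[-> | ->]]; assumption.
- rewrite T in Ht1.
  change ((px (fun z => Re (t z)) z - py (fun z => Im (t z)) z) / 2 = Re (RtoC (f (2 * Re z)%R) ^ 2 / 2)%C) in Ht1.
  replace x with (2 * Re z) by (unfold z, Re; simpl; field).
  revert Ht1; generalize (px (fun z => Re (t z)) z) (py (fun z => Im (t z)) z) (f (2 * Re z)).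
  intros a b c; unfold Re; simpl; intros; field_simplify in Ht1; lra.
- rewrite T in Ht2.
  change ((px (fun z => Im (t z)) z + py (fun z => Re (t z)) z) / 2 = Im (RtoC (f (2 * Re z)%R) ^ 2 / 2)%C) in Ht2.
  revert Ht2; generalize (px (fun z => Im (t z)) z) (py (fun z => Re (t z)) z) (f (2 * Re z)).
  intros a b c; unfold Im; simpl; intros; field_simplify in Ht2; lra.
Qed.

(** * Liouville's equation *)

(* [auto_derive] eta-expands the functions it meets. *)
Ltac eta_Derive := repeat match goal with
  |- context [Derive (fun x => ?f x) ?y] =>
     progress change (Derive (fun x => f x) y) with (Derive f y) end.

Lemma locally_constant (g : R -> R) :
  locally 0 (fun x => is_derive g x 0) -> locally 0 (fun x => g x = g 0).
Proof.
intros [e He]; exists e; intros x Hx.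
change (Rabs (x - 0) < e) in Hx; rewrite Rminus_0_r in Hx; apply Rabs_def2 in Hx.
assert (He' : forall y, - e < y < e -> is_derive g y 0).
{ intros y Hy; apply He; change (Rabs (y - 0) < e); rewrite Rminus_0_r; apply Rabs_def1; lra. }
destruct (Rtotal_order x 0) as [L|[->|L]]; [|reflexivity|].
- apply (eq_is_derive g); [|exact L]; intros y Hy; apply He'; lra.
- symmetry; apply (eq_is_derive g); [|exact L]; intros y Hy; apply He'; lra.
Qed.

(** The cosine and sine of the equation w'' = k w: trigonometric, affine or
    hyperbolic according to the sign of [k]. *)
Definition fundamental (k : R) (c s : R -> R) : Prop :=
  c 0 = 1 /\ s 0 = 0 /\
  forall x, is_derive c x (k * s x) /\ is_derive s x (c x).

Lemma fundamental_exists (k : R) : exists c s, fundamental k c s.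
Proof.
destruct (Rtotal_order k 0) as [L|[->|L]].
- set (m := sqrt (- k)).
  assert (Hm : 0 < m) by (apply sqrt_lt_R0; lra).
  assert (Hk : k = - (m * m)) by (unfold m; rewrite sqrt_sqrt; lra).
  exists (fun x => cos (m * x)), (fun x => sin (m * x) / m).
  split; [|split; [|intros x; split]].
  + rewrite Rmult_0_r; apply cos_0.
  + rewrite Rmult_0_r, sin_0; field; lra.
  + auto_derive; [exact I|rewrite Hk; field; lra].
  + auto_derive; [exact I|field; lra].
- exists (fun _ => 1), (fun x => x); split; [|split; [|intros x; split; auto_derive]]; trivial; ring.
- set (m := sqrt k).
  assert (Hm : 0 < m) by (apply sqrt_lt_R0; lra).
  assert (Hk : k = m * m) by (unfold m; rewrite sqrt_sqrt; lra).
  exists (fun x => cosh (m * x)), (fun x => sinh (m * x) / m).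
  unfold cosh, sinh; split; [|split; [|intros x; split]].
  + rewrite Rmult_0_r, Ropp_0, exp_0; field.
  + rewrite Rmult_0_r, Ropp_0, exp_0; field; lra.
  + auto_derive; [exact I|rewrite Hk; field; lra].
  + auto_derive; [exact I|field; lra].
Qed.

Lemma fundamental_pythagoras k c s :
  fundamental k c s -> forall x, c x ^ 2 - k * s x ^ 2 = 1.
Proof.
intros (c0 & s0 & H).
set (g := fun x => c x ^ 2 - k * s x ^ 2).
assert (D : forall x, is_derive g x 0).
{ intros x; destruct (H x) as [Hc Hs]; unfold g.
  auto_derive; [split; [eexists; exact Hc|split;[eexists; exact Hs|exact I]]|].
  eta_Derive; rewrite (is_derive_unique c x _ Hc), (is_derive_unique s x _ Hs); ring. }
assert (g0 : g 0 = 1) by (unfold g; rewrite c0, s0; ring).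
intros x; change (g x = 1); rewrite <- g0.
destruct (Rtotal_order x 0) as [L|[->|L]]; [|reflexivity|].
- apply (eq_is_derive g); [|exact L]; intros y _; apply D.
- symmetry; apply (eq_is_derive g); [|exact L]; intros y _; apply D.
Qed.

(** By variation of constants: w c - w' s and w' c - k w s have derivative zero. *)
Lemma fundamental_solution k c s (w v : R -> R) :
  fundamental k c s ->
  locally 0 (fun x => is_derive w x (v x) /\ is_derive v x (k * w x)) ->
  locally 0 (fun x => w x = w 0 * c x + v 0 * s x /\
                      v x = v 0 * c x + k * w 0 * s x).
Proof.
intros Hf Hw; assert (P := fundamental_pythagoras _ _ _ Hf).
destruct Hf as (c0 & s0 & H).
assert (A : locally 0 (fun x => w x * c x - v x * s x = w 0 * c 0 - v 0 * s 0)).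
{ apply (locally_constant (fun x => w x * c x - v x * s x)).
  revert Hw; apply filter_imp; intros x [Dw Dv]; destruct (H x) as [Dc Ds].
  auto_derive; [repeat split; eexists; eassumption|].
  eta_Derive; rewrite (is_derive_unique c x _ Dc), (is_derive_unique s x _ Ds),
    (is_derive_unique w x _ Dw), (is_derive_unique v x _ Dv); ring. }
assert (B : locally 0 (fun x => v x * c x - k * (w x * s x) = v 0 * c 0 - k * (w 0 * s 0))).
{ apply (locally_constant (fun x => v x * c x - k * (w x * s x))).
  revert Hw; apply filter_imp; intros x [Dw Dv]; destruct (H x) as [Dc Ds].
  auto_derive; [repeat split; eexists; eassumption|].
  eta_Derive; rewrite (is_derive_unique c x _ Dc), (is_derive_unique s x _ Ds),
    (is_derive_unique w x _ Dw), (is_derive_unique v x _ Dv); ring. }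
generalize (filter_and _ _ A B); apply filter_imp; intros x [Ax Bx].
rewrite c0, s0 in Ax, Bx; specialize (P x).
assert (Aw : w 0 = w x * c x - v x * s x) by lra.
assert (Bv : v 0 = v x * c x - k * (w x * s x)) by lra.
split.
- transitivity (w x * (c x ^ 2 - k * s x ^ 2)); [rewrite P; ring|rewrite Aw, Bv; ring].
- transitivity (v x * (c x ^ 2 - k * s x ^ 2)); [rewrite P; ring|rewrite Aw, Bv; ring].
Qed.

(** Both sides solve w'' = k w with the same data at 0. *)
Lemma fundamental_double k c s :
  fundamental k c s ->
  locally 0 (fun x => c (2 * x) = c x ^ 2 + k * s x ^ 2 /\ s (2 * x) = 2 * (s x * c x)).
Proof.
intros Hf; assert (Hf' := Hf); destruct Hf' as (c0 & s0 & H).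
assert (D : forall x, is_derive c (x / 2) (k * s (x / 2)) /\ is_derive s (x / 2) (c (x / 2))) by (intros x; apply H).
assert (E := fundamental_solution k c s
  (fun x => 2 * (s (x / 2) * c (x / 2))) (fun x => c (x / 2) ^ 2 + k * s (x / 2) ^ 2) Hf).
destruct E as [e He].
- apply filter_forall; intros x; destruct (D x) as [Dc Ds]; split; auto_derive;
  try (repeat split; eexists; eassumption);
  change (x * / 2) with (x / 2);
  eta_Derive; rewrite (is_derive_unique c _ _ Dc), (is_derive_unique s _ _ Ds); field.
- exists (pos_div_2 e); intros x Hx.
  change (Rabs (x - 0) < e / 2) in Hx; rewrite Rminus_0_r in Hx.
  destruct (He (2 * x)) as [E1 E2].
  { change (Rabs (2 * x - 0) < e); rewrite Rminus_0_r, Rabs_mult, (Rabs_pos_eq 2); lra. }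
  assert (X : forall y : R, 2 * y / 2 = y) by (intros; field).
  assert (X0 : 0 / 2 = 0) by field.
  rewrite X, X0, c0, s0 in E1, E2; split; lra.
Qed.

(** The equation says (log f)'' = f^2. Hence k = (f'/f)^2 - f^2 is constant, and
    w = 1/f satisfies the linear equation w'' = k w, with w'^2 - k w^2 = 1. *)
Lemma liouville_reciprocal (f : R -> R) :
  locally 0 (fun x => 0 < f x) ->
  locally 0 (fun x => ex_derive f x /\ ex_derive (Derive f) x) ->
  locally 0 (fun x => f x * Derive (Derive f) x = Derive f x ^ 2 + f x ^ 4) ->
  exists k a b, 0 < a /\ b ^ 2 - k * a ^ 2 = 1 /\
  forall c s, fundamental k c s ->
  locally 0 (fun x => / f x = a * c x + b * s x /\
                      - Derive f x / f x ^ 2 = b * c x + k * a * s x).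
Proof.
intros Hp Hd Ho.
set (h := fun x => (Derive f x / f x) ^ 2 - f x ^ 2).
assert (Hh : locally 0 (fun x => h x = h 0)).
{ apply locally_constant.
  generalize (filter_and _ _ Hp (filter_and _ _ Hd Ho)); apply filter_imp.
  intros x (P & [D1 D2] & E); unfold h.
  auto_derive; [repeat split; trivial; lra|].
  eta_Derive.
  replace (Derive (Derive f) x) with ((Derive f x ^ 2 + f x ^ 4) / f x) by (rewrite <- E; field; lra).
  field; lra. }
exists (h 0), (/ f 0), (- Derive f 0 / f 0 ^ 2).
assert (P0 := locally_singleton _ _ Hp); simpl in P0.
split; [apply Rinv_0_lt_compat, P0|split].
{ unfold h; field; lra. }
intros c s Hf.
apply (fundamental_solution _ _ _ (fun x => / f x) (fun x => - Derive f x / f x ^ 2) Hf).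
generalize (filter_and _ _ Hh (filter_and _ _ Hp (filter_and _ _ Hd Ho))); apply filter_imp.
intros x (K & P & [D1 D2] & E); rewrite <- K; clear K; split.
- auto_derive; [repeat split; trivial; lra|].
  eta_Derive; field; lra.
- auto_derive; [repeat split; trivial; apply Rgt_not_eq; nra|].
  eta_Derive.
  replace (Derive (Derive f) x) with ((Derive f x ^ 2 + f x ^ 4) / f x) by (rewrite <- E; field; lra).
  unfold h; field; lra.
Qed.

(** * Complex differentiability from the Cauchy-Riemann equations *)

(** Complex differentiability for the product uniform structure of [C], the one
    used on the factors of [C2]. *)
Definition is_Cderive (f : C -> C) (z l : C) : Prop :=
  filterdiff (K := C_AbsRing) (U := C_NormedModule) (V := C_NormedModule)
    f (locally z) (fun h => Cmult h l).

Lemma is_linear_Cmult (l : C) :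
  is_linear (K := C_AbsRing) (U := C_NormedModule) (V := C_NormedModule) (fun h => Cmult h l).
Proof.
split.
- intros x y; change (((x + y) * l = x * l + y * l)%C); ring.
- intros x y; change ((x * y * l = x * (y * l))%C); ring.
- exists (Cmod l + 1); split; [generalize (Cmod_ge_0 l); lra|].
  intros x; change (Cmod (x * l) <= (Cmod l + 1) * Cmod x).
  rewrite Cmod_mult; generalize (Cmod_ge_0 x); nra.
Qed.

Lemma is_Cderive_intro (f : C -> C) (z l : C) :
  (forall e : posreal, locally (T := C_UniformSpace) z (fun y =>
     Cmod (f y - f z - (y - z) * l)%C <= e * Cmod (y - z)%C)) ->
  is_Cderive f z l.
Proof.
intros H; split; [apply is_linear_Cmult|].
intros x Hx e.
apply (is_filter_lim_locally_unique (K := C_AbsRing) (V := C_NormedModule)) in Hx; subst x.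
exact (H e).
Qed.

(** The errors of the real and imaginary parts combine with the factor sqrt 2 <= 2,
    hence the estimates at e / 2. *)
Lemma cauchy_riemann (f : C -> C) (z : C) (a b : R) :
  differentiable_pt_lim (fun x y => Re (f (x, y))) (Re z) (Im z) a (- b) ->
  differentiable_pt_lim (fun x y => Im (f (x, y))) (Re z) (Im z) b a ->
  is_Cderive f z (a, b).
Proof.
intros Hu Hv; apply is_Cderive_intro; intros e.
assert (He : 0 < e / 2) by (generalize (cond_pos e); lra).
assert (H := locally_2d_and _ _ _ _ (Hu (mkposreal _ He)) (Hv (mkposreal _ He))).
apply locally_2d_locally in H.
destruct z as [x y]; revert H; apply filter_imp; intros [x' y']; unfold Re, Im; cbn [fst snd pos].
set (m := Rmax (Rabs (x' - x)) (Rabs (y' - y))).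
intros [H1 H2].
assert (Hm : m <= Cmod ((x', y') - (x, y))%C) by exact (Rmax_Cmod ((x', y') - (x, y))%C).
set (D := ((x', y') - (x, y))%C) in *.
set (E := (f (x', y') - f (x, y) - D * (a, b))%C).
eapply Rle_trans; [apply (Cmod_2Rmax E)|].
assert (Hs : sqrt 2 <= 2).
{ rewrite <- (sqrt_square 2) at 2; [apply sqrt_le_1; lra|lra]. }
assert (HE : Rmax (Rabs (fst E)) (Rabs (snd E)) <= e / 2 * m).
{ apply Rmax_lub.
  - eapply Rle_trans; [|exact H1]; right; f_equal; unfold E, D; simpl; ring.
  - eapply Rle_trans; [|exact H2]; right; f_equal; unfold E, D; simpl; ring. }
assert (Hs0 := sqrt_pos 2).
assert (Hm0 : 0 <= m) by (apply Rle_trans with (1 := Rabs_pos _) (2 := Rmax_l _ _)).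
apply Rle_trans with (2 * (e / 2 * m)).
- apply Rmult_le_compat; trivial; apply Rle_trans with (1 := Rabs_pos (fst E)) (2 := Rmax_l _ _).
- replace (2 * (e / 2 * m)) with (e * m) by field.
  apply Rmult_le_compat_l; [left; apply cond_pos|exact Hm].
Qed.

(** Frechet differentiability needs continuity of only one of the two partial
    derivatives, the other being required at the point alone. *)
Lemma differentiable_weakly_C1 (w : C -> R) (z : C) :
  locally (T := C_UniformSpace) z
    (fun y => ex_derive (along (V := C_NormedModule) w y (RtoC 1)) 0) ->
  ex_derive (along (V := C_NormedModule) w z (scal Ci (RtoC 1))) 0 ->
  continuous (T := C_UniformSpace) (px w) z ->
  differentiable_pt_lim (fun x y => w (x, y)) (Re z) (Im z) (px w z) (py w z).
Proof.
intros Hx Hy Hc.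
apply filterdiff_differentiable_pt_lim.
assert (T : forall (g : R -> R) x l, is_derive (fun s => g (x + s)) 0 l -> is_derive g x l).
{ intros g x l H.
  apply is_derive_ext with (f := fun y => g (x + (y - x))); [intros; f_equal; ring|].
  replace l with (scal 1 l) by apply (scal_one l).
  apply (is_derive_comp (fun s => g (x + s)) (fun y => y - x)).
  - replace (x - x) with 0 by ring; exact H.
  - auto_derive; trivial. }
destruct z as [x y].
apply (is_derive_filterdiff (fun x y => w (x, y)) x y (fun x y => px w (x, y)) (py w (x, y))).
- revert Hx; apply filter_imp; intros [x' y'] H.
  apply T; apply Derive_correct in H; unfold px.
  eapply is_derive_ext; [|exact H].
  intros s; unfold along; rewrite shift_x; reflexivity.
- apply T; apply Derive_correct in Hy; unfold py.
  eapply is_derive_ext; [|exact Hy].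
  intros s; unfold along; rewrite shift_y; reflexivity.
- apply continuous_ext_loc with (g := px w); [|exact Hc].
  apply filter_forall; intros [x' y']; reflexivity.
Qed.

(** Weaker than continuous differentiability, but enough for [differentiable_weakly_C1]
    and easier to check. *)
Definition weakly_C1_at (w : C -> R) (z : C) : Prop :=
  locally (T := C_UniformSpace) z
    (fun y => ex_derive (along (V := C_NormedModule) w y (RtoC 1)) 0) /\
  ex_derive (along (V := C_NormedModule) w z (scal Ci (RtoC 1))) 0 /\
  continuous (T := C_UniformSpace) (px w) z.

Lemma is_Cderive_dbar (f : C -> C) (z : C) :
  weakly_C1_at (fun y => Re (f y)) z -> weakly_C1_at (fun y => Im (f y)) z -> dbar f z = 0%C ->
  is_Cderive f z (px (fun y => Re (f y)) z, px (fun y => Im (f y)) z).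
Proof.
intros (u1 & u2 & u3) (v1 & v2 & v3) H.
assert (H1 := f_equal Re H); assert (H2 := f_equal Im H).
unfold dbar in H1, H2; rewrite Re_dzbar in H1; rewrite Im_dzbar in H2.
change ((px (fun y => Re (f y)) z - py (fun y => Im (f y)) z) / 2 = 0) in H1.
change ((px (fun y => Im (f y)) z + py (fun y => Re (f y)) z) / 2 = 0) in H2.
assert (Du := differentiable_weakly_C1 _ _ u1 u2 u3).
assert (Dv := differentiable_weakly_C1 _ _ v1 v2 v3).
apply cauchy_riemann.
- replace (- px (fun y => Im (f y)) z) with (py (fun y => Re (f y)) z) by lra; exact Du.
- replace (px (fun y => Re (f y)) z) with (py (fun y => Im (f y)) z) by lra; exact Dv.
Qed.

Lemma along_separated (g h g' h' : R -> R) (z : C) :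
  (forall x, is_derive g x (g' x)) -> (forall x, is_derive h x (h' x)) ->
  is_derive (along (V := C_NormedModule) (fun y => g (Re y) * h (Im y)) z (RtoC 1)) 0
    (g' (Re z) * h (Im z)) /\
  is_derive (along (V := C_NormedModule) (fun y => g (Re y) * h (Im y)) z (scal Ci (RtoC 1))) 0
    (g (Re z) * h' (Im z)).
Proof.
intros Hg Hh; split.
- apply is_derive_ext with (f := fun s => g (Re z + s) * h (Im z)).
  { intros s; unfold along; rewrite shift_x; reflexivity. }
  assert (D := Hg (Re z + 0)).
  auto_derive; [repeat split; eexists; exact D|].
  eta_Derive; rewrite (is_derive_unique _ _ _ D), Rplus_0_r; real_eq; ring.
- apply is_derive_ext with (f := fun s => g (Re z) * h (Im z + s)).
  { intros s; unfold along; rewrite shift_y; reflexivity. }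
  assert (D := Hh (Im z + 0)).
  auto_derive; [repeat split; eexists; exact D|].
  eta_Derive; rewrite (is_derive_unique _ _ _ D), Rplus_0_r; real_eq; ring.
Qed.

Lemma weakly_C1_separated (g h g' h' : R -> R) (z : C) :
  (forall x, is_derive g x (g' x)) -> (forall x, is_derive h x (h' x)) ->
  (forall x, ex_derive g' x) ->
  weakly_C1_at (fun y => g (Re y) * h (Im y)) z.
Proof.
intros Hg Hh Hg'; split; [|split].
- apply filter_forall; intros y.
  exists (g' (Re y) * h (Im y)); exact (proj1 (along_separated g h g' h' y Hg Hh)).
- exists (g (Re z) * h' (Im z)); exact (proj2 (along_separated g h g' h' z Hg Hh)).
- apply continuous_ext with (f := fun y : C_UniformSpace => g' (Re y) * h (Im y)).
  { intros y; symmetry.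
    exact (is_derive_unique _ _ _ (proj1 (along_separated g h g' h' y Hg Hh))). }
  apply (continuous_mult (fun y : C_UniformSpace => g' (Re y)) (fun y => h (Im y))).
  + apply (continuous_comp (fun y : C_UniformSpace => Re y) g').
    * apply continuous_fst.
    * apply (ex_derive_continuous g'), Hg'.
  + apply (continuous_comp (fun y : C_UniformSpace => Im y) h).
    * apply continuous_snd.
    * apply (ex_derive_continuous h); exists (h' (Im z)); apply Hh.
Qed.

Lemma is_Cderive_ext (f g : C -> C) (z l : C) :
  (forall y, f y = g y) -> is_Cderive f z l -> is_Cderive g z l.
Proof.
intros H; apply (filterdiff_ext (K := C_AbsRing) (U := C_NormedModule) (V := C_NormedModule)), H.
Qed.

Lemma is_Cderive_separated (g1 h1 g2 h2 g1' h1' g2' h2' : R -> R) (z : C) :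
  (forall x, is_derive g1 x (g1' x)) -> (forall x, is_derive h1 x (h1' x)) ->
  (forall x, is_derive g2 x (g2' x)) -> (forall x, is_derive h2 x (h2' x)) ->
  (forall x, ex_derive g1' x) -> (forall x, ex_derive g2' x) ->
  g1' (Re z) * h1 (Im z) = g2 (Re z) * h2' (Im z) ->
  g2' (Re z) * h2 (Im z) = - (g1 (Re z) * h1' (Im z)) ->
  is_Cderive (fun z => (g1 (Re z) * h1 (Im z), g2 (Re z) * h2 (Im z))) z
    (g1' (Re z) * h1 (Im z), g2' (Re z) * h2 (Im z)).
Proof.
intros D1 E1 D2 E2 X1 X2 CR1 CR2.
destruct (along_separated g1 h1 g1' h1' z D1 E1) as [A1 B1].
destruct (along_separated g2 h2 g2' h2' z D2 E2) as [A2 B2].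
assert (K1 := weakly_C1_separated g1 h1 g1' h1' z D1 E1 X1).
assert (K2 := weakly_C1_separated g2 h2 g2' h2' z D2 E2 X2).
assert (L := is_Cderive_dbar (fun z => (g1 (Re z) * h1 (Im z), g2 (Re z) * h2 (Im z))) z K1 K2).
replace (g1' (Re z) * h1 (Im z), g2' (Re z) * h2 (Im z)) with
  (px (fun y => g1 (Re y) * h1 (Im y)) z, px (fun y => g2 (Re y) * h2 (Im y)) z).
2: { f_equal; apply is_derive_unique; assumption. }
apply L; unfold dbar.
apply (eq_trans (proj2 (dz_eq (V := C_NormedModule)
  (fun z => (g1 (Re z) * h1 (Im z), g2 (Re z) * h2 (Im z))) z (RtoC 1)
  _ _ _ _ A1 A2 B1 B2))).
rewrite CR1, CR2; unfold RtoC; f_equal; field.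
Qed.

(** * Entire solutions of the linear equation *)

Section Entire.
Context (k : R) (c s c' s' : R -> R).
Context (Hcs : fundamental k c s) (Hcs' : fundamental (- k) c' s').

(** The entire extensions of [c] and [s], from the addition formulas: along the
    imaginary axis the equation w'' = k w turns into w'' = - k w. *)
Definition cosC (z : C) : C := (c (Re z) * c' (Im z), k * (s (Re z) * s' (Im z))).
Definition sinC (z : C) : C := (s (Re z) * c' (Im z), c (Re z) * s' (Im z)).

Lemma is_Cderive_cosC z : is_Cderive cosC z (RtoC k * sinC z)%C.
Proof.
destruct Hcs as (c0 & s0 & H); destruct Hcs' as (c0' & s0' & H').
replace (RtoC k * sinC z)%C with
  (k * s (Re z) * c' (Im z), k * c (Re z) * s' (Im z)).
2: { unfold sinC, Cmult, RtoC; apply injective_projections; simpl; ring. }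
apply is_Cderive_ext with (fun z => (c (Re z) * c' (Im z), k * s (Re z) * s' (Im z))).
{ intros y; unfold cosC; f_equal; ring. }
apply (is_Cderive_separated c c' (fun x => k * s x) s' (fun x => k * s x)
  (fun x => - k * s' x) (fun x => k * c x) c').
1, 2, 4: intros x; try apply H; apply H'.
- intros x; apply (is_derive_scal s), H.
- intros x; exists (k * c x); apply (is_derive_scal s), H.
- intros x; exists (k * (k * s x)); apply (is_derive_scal c), H.
- ring.
- ring.
Qed.

Lemma is_Cderive_sinC z : is_Cderive sinC z (cosC z).
Proof.
destruct Hcs as (c0 & s0 & H); destruct Hcs' as (c0' & s0' & H').
replace (cosC z) with (c (Re z) * c' (Im z), k * s (Re z) * s' (Im z)).
2: { unfold cosC; f_equal; ring. }
apply (is_Cderive_separated s c' c s' c (fun x => - k * s' x) (fun x => k * s x) c').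
1, 2, 3, 4: intros x; try apply H; apply H'.
- intros x; exists (k * s x); apply H.
- intros x; exists (k * c x); apply (is_derive_scal s), H.
- ring.
- ring.
Qed.

Lemma cosC_0 : cosC 0 = 1.
Proof.
destruct Hcs as (c0 & s0 & _); destruct Hcs' as (c0' & s0' & _).
unfold cosC, RtoC, Re, Im; cbn [fst snd]; rewrite c0, c0', s0; f_equal; ring.
Qed.

Lemma sinC_0 : sinC 0 = 0.
Proof.
destruct Hcs as (c0 & s0 & _); destruct Hcs' as (c0' & s0' & _).
unfold sinC, RtoC, Re, Im; cbn [fst snd]; rewrite s0, s0'; f_equal; ring.
Qed.

Lemma cosC_sinC_pythagoras z : (cosC z * cosC z - RtoC k * (sinC z * sinC z) = 1)%C.
Proof.
assert (P := fundamental_pythagoras _ _ _ Hcs (Re z)).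
assert (P' := fundamental_pythagoras _ _ _ Hcs' (Im z)).
unfold cosC, sinC, RtoC, Cminus, Cplus, Copp, Cmult; cbn [fst snd].
revert P P'; generalize (c (Re z)) (s (Re z)) (c' (Im z)) (s' (Im z)).
intros C S C' S' P P'; f_equal; [|ring].
transitivity ((C ^ 2 - k * S ^ 2) * (C' ^ 2 - - k * S' ^ 2)); [ring|rewrite P, P'; ring].
Qed.

(** The addition formulas for z + conj z, followed by the duplication formulas on
    the real axis. *)
Lemma cosC_sinC_conj z :
  (cosC z * Cconj (cosC z) + RtoC k * (sinC z * Cconj (sinC z)) =
     RtoC (c (Re z) ^ 2 + k * s (Re z) ^ 2) /\
   sinC z * Cconj (cosC z) + cosC z * Cconj (sinC z) = RtoC (2 * (s (Re z) * c (Re z))))%C.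
Proof.
assert (P' := fundamental_pythagoras _ _ _ Hcs' (Im z)).
unfold cosC, sinC, RtoC, Cconj, Cminus, Cplus, Copp, Cmult; cbn [fst snd].
revert P'; generalize (c (Re z)) (s (Re z)) (c' (Im z)) (s' (Im z)).
intros C S C' S' P'; split; (f_equal; [|ring]).
- transitivity ((C ^ 2 + k * S ^ 2) * (C' ^ 2 - - k * S' ^ 2)); [ring|rewrite P'; ring].
- transitivity (2 * (S * C) * (C' ^ 2 - - k * S' ^ 2)); [ring|rewrite P'; ring].
Qed.
End Entire.

(** * Calculus of complex derivatives *)

Local Open Scope C_scope.

(** [C] carries two normed structures, with equal norms but different balls; the
    product rule lives on one of them, holomorphy on the other. *)
Lemma filterdiff_C_AbsRing {U : NormedModule C_AbsRing} (f l : U -> C) (F : (U -> Prop) -> Prop) :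
  filterdiff (V := C_NormedModule) f F l <->
  filterdiff (V := AbsRing_NormedModule C_AbsRing) f F l.
Proof. split; intros [H H']; (split; [split; apply H|exact H']). Qed.

Lemma filterdiff_Cmult {U : NormedModule C_AbsRing} (f g lf lg : U -> C) (p : U) :
  filterdiff (K := C_AbsRing) (V := C_NormedModule) f (locally p) lf ->
  filterdiff (K := C_AbsRing) (V := C_NormedModule) g (locally p) lg ->
  filterdiff (K := C_AbsRing) (V := C_NormedModule) (fun q => f q * g q) (locally p)
    (fun h => lf h * g p + f p * lg h).
Proof.
rewrite !filterdiff_C_AbsRing; intros Hf Hg.
exact (filterdiff_mult_fct (K := C_AbsRing) f g p lf lg Cmult_comm Hf Hg).
Qed.

Lemma is_Cderive_const (a z : C) : is_Cderive (fun _ => a) z 0.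
Proof.
apply (filterdiff_ext_lin (K := C_AbsRing) (U := C_NormedModule) (V := C_NormedModule) _
  (fun _ => zero)).
- apply filterdiff_const; apply locally_filter.
- intros h; change (RtoC 0 = Cmult h (RtoC 0)); ring.
Qed.

Lemma is_Cderive_plus (f g : C -> C) (z a b : C) :
  is_Cderive f z a -> is_Cderive g z b -> is_Cderive (fun y => f y + g y) z (a + b).
Proof.
intros Hf Hg.
apply (filterdiff_ext_lin (K := C_AbsRing) (U := C_NormedModule) (V := C_NormedModule) _
  (fun h => h * a + h * b)).
- exact (filterdiff_plus_fct (K := C_AbsRing) (U := C_NormedModule) (V := C_NormedModule) _ _ _ _ Hf Hg).
- intros h; complex_eq; ring.
Qed.

Lemma is_Cderive_mult (f g : C -> C) (z a b : C) :
  is_Cderive f z a -> is_Cderive g z b ->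
  is_Cderive (fun y => f y * g y) z (a * g z + f z * b).
Proof.
intros Hf Hg.
apply (filterdiff_ext_lin (K := C_AbsRing) (U := C_NormedModule) (V := C_NormedModule) _
  (fun h => h * a * g z + f z * (h * b))).
- exact (filterdiff_Cmult (U := C_NormedModule) _ _ _ _ _ Hf Hg).
- intros h; complex_eq; ring.
Qed.

Lemma is_Cderive_Cinv (z : C) : z <> 0 -> is_Cderive Cinv z (- / (z * z)).
Proof.
intros Hz; apply is_Cderive_intro; intros e.
assert (Hm := proj1 (Cmod_gt_0 z) Hz).
set (m := Cmod z) in *.
(* The error is |y - z|^2 / (m^2 |y|), and |y| >= m / 2 within distance m / 2. *)
set (d := Rmin (m / 2) (e * (m * m * m) / 2)).
assert (Hd : (0 < d)%R).
{ apply Rmin_pos; [lra|].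
  apply Rdiv_lt_0_compat; [|lra]; repeat apply Rmult_lt_0_compat; trivial; apply cond_pos. }
apply (locally_le_locally_norm (K := C_AbsRing) (V := C_NormedModule) z).
exists (mkposreal d Hd); intros y Hy.
change (Cmod (y - z) < d)%R in Hy.
assert (H1 : (d <= m / 2)%R) by apply Rmin_l.
assert (H2 : (d <= e * (m * m * m) / 2)%R) by apply Rmin_r.
assert (Hy2 : (m / 2 < Cmod y)%R).
{ assert (T := Cmod_triangle y (z - y)).
  replace (y + (z - y)) with z in T by ring; fold m in T.
  replace (z - y) with (- (y - z)) in T by ring; rewrite Cmod_opp in T; lra. }
assert (Hy0 : (y : C) <> RtoC 0) by (apply Cmod_gt_0; lra).
replace (/ y - / z - (y - z) * - / (z * z)) with ((y - z) * (y - z) / (z * z * y)).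
2: { field; split; assumption. }
rewrite Cmod_div by (repeat apply Cmult_neq_0; assumption).
rewrite !Cmod_mult; fold m.
set (x := Cmod (y - z)) in *; assert (Hx : (0 <= x)%R) by apply Cmod_ge_0.
apply Rle_div_l; [repeat apply Rmult_lt_0_compat; lra|].
apply Rle_trans with (x * (e * (m * m * m) / 2))%R.
- apply Rmult_le_compat_l; lra.
- replace (x * (e * (m * m * m) / 2))%R with (e * x * (m * m) * (m / 2))%R by field.
  replace (e * x * (m * m * Cmod y))%R with (e * x * (m * m) * Cmod y)%R by ring.
  apply Rmult_le_compat_l; [|lra].
  apply Rmult_le_pos; [apply Rmult_le_pos; [left; apply cond_pos|exact Hx]|nra].
Qed.

Lemma is_Cderive_inv (f : C -> C) (z a : C) :
  is_Cderive f z a -> f z <> 0 -> is_Cderive (fun y => / f y) z (- a / (f z * f z)).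
Proof.
intros Hf Hz.
apply (filterdiff_ext_lin (K := C_AbsRing) (U := C_NormedModule) (V := C_NormedModule) _
  (fun h => h * a * - / (f z * f z))).
- exact (filterdiff_comp' (K := C_AbsRing) (U := C_NormedModule) (V := C_NormedModule)
    (W := C_NormedModule) f Cinv z _ _ Hf (is_Cderive_Cinv _ Hz)).
- intros h; complex_eq; field; exact Hz.
Qed.

Lemma is_Cderive_continuous (f : C -> C) (z a : C) :
  is_Cderive f z a -> continuous (T := C_UniformSpace) (U := C_UniformSpace) f z.
Proof.
intros H; apply (filterdiff_continuous (K := C_AbsRing) (U := C_NormedModule) (V := C_NormedModule)).
eexists; exact H.
Qed.

Lemma filterdiff_fst2 (p : C2) :
  filterdiff (K := C_AbsRing) (U := C2) (V := C_NormedModule) (fun q => fst q) (locally p) (fun h => fst h).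
Proof. apply filterdiff_linear, is_linear_fst. Qed.

Lemma filterdiff_comp_snd (f : C -> C) (p : C2) (a : C) :
  is_Cderive f (snd p) a ->
  filterdiff (K := C_AbsRing) (U := C2) (V := C_NormedModule) (fun q => f (snd q)) (locally p)
    (fun h => snd h * a).
Proof.
intros H.
apply (filterdiff_comp' (K := C_AbsRing) (U := C2) (V := C_NormedModule)
    (W := C_NormedModule) (fun q => snd q) f p (fun h => snd h) (fun h => h * a)).
- apply filterdiff_linear, is_linear_snd.
- exact H.
Qed.

Lemma filterdiff_pair {T U V : NormedModule C_AbsRing} (f : T -> U) (g : T -> V)
    (lf : T -> U) (lg : T -> V) (x : T) :
  filterdiff f (locally x) lf -> filterdiff g (locally x) lg ->
  filterdiff (V := prod_NormedModule C_AbsRing U V) (fun y => (f y, g y)) (locally x) (fun h => (lf h, lg h)).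
Proof.
intros Hf Hg.
apply (filterdiff_comp'_2 (W := prod_NormedModule C_AbsRing U V) f g (fun a b => (a, b)) x lf lg (fun a b => (a, b))); trivial.
apply filterdiff_ext with (f := fun t => t); [intros []; reflexivity|].
apply filterdiff_ext_lin with (l1 := fun t => t); [|intros []; reflexivity].
apply filterdiff_id.
Qed.

Definition holomorphic1 (f : C -> C) : Prop :=
  locally (T := C_UniformSpace) (RtoC 0) (fun z => exists l, is_Cderive f z l).

Lemma holomorphic1_mult (f g : C -> C) :
  holomorphic1 f -> holomorphic1 g -> holomorphic1 (fun z => f z * g z).
Proof.
unfold holomorphic1; intros Hf Hg; generalize (filter_and _ _ Hf Hg); apply filter_imp.
intros z [[a Ha] [b Hb]]; eexists; exact (is_Cderive_mult _ _ _ _ _ Ha Hb).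
Qed.

Lemma holomorphic1_plus (f g : C -> C) :
  holomorphic1 f -> holomorphic1 g -> holomorphic1 (fun z => f z + g z).
Proof.
unfold holomorphic1; intros Hf Hg; generalize (filter_and _ _ Hf Hg); apply filter_imp.
intros z [[a Ha] [b Hb]]; eexists; exact (is_Cderive_plus _ _ _ _ _ Ha Hb).
Qed.

Lemma holomorphic1_const (a : C) : holomorphic1 (fun _ => a).
Proof. unfold holomorphic1; apply filter_forall; intros z; exists (RtoC 0); apply is_Cderive_const. Qed.

Lemma holomorphic1_near_neq_0 (f : C -> C) :
  holomorphic1 f -> f 0 <> 0 -> locally (T := C_UniformSpace) (RtoC 0) (fun z => f z <> 0).
Proof.
intros Hf f0; destruct (locally_singleton _ _ Hf) as [l Hl].
refine (is_Cderive_continuous _ _ _ Hl (fun y => (y : C) <> RtoC 0) _).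
apply (locally_le_locally_norm (K := C_AbsRing) (V := C_NormedModule)).
assert (Hm := proj1 (Cmod_gt_0 _) f0).
exists (mkposreal _ Hm); intros y Hy ->.
change (Cmod (0 - f 0) < Cmod (f 0))%R in Hy.
replace (0 - f 0) with (- f 0) in Hy by ring; rewrite Cmod_opp in Hy; lra.
Qed.

Lemma holomorphic1_inv (f : C -> C) :
  holomorphic1 f -> f 0 <> 0 -> holomorphic1 (fun z => / f z).
Proof.
intros Hf f0; unfold holomorphic1; generalize (filter_and _ _ Hf (holomorphic1_near_neq_0 f Hf f0)); apply filter_imp.
intros z [[a Ha] Hz]; eexists; exact (is_Cderive_inv _ _ _ Ha Hz).
Qed.

(** * The tube over the light cone *)

Local Open Scope R_scope.

Section Ck.
Context {V : NormedModule C_AbsRing} (U : V -> Prop) (oU : open U).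

Lemma Ck_on_ext k (f g : V -> R) :
  (forall p, U p -> f p = g p) -> Ck_on k U f -> Ck_on k U g.
Proof.
revert f g; induction k as [|k IH]; intros f g E [H1 H2];
  (assert (E' : forall p, U p -> locally p (fun q => f q = g q));
   [intros p Up; apply (locally_open U); trivial|]); split.
1, 3: intros p Up; apply continuous_ext_loc with f; [apply E', Up|apply H1, Up].
- exact I.
- intros v; destruct (H2 v) as [D C]; split.
  + intros p Up; destruct (D p Up) as [l Hl]; exists l.
    apply (along_ext g f); [|exact Hl].
    generalize (E' p Up); apply filter_imp; intros q Hq; symmetry; exact Hq.
  + apply IH with (2 := C); intros p Up; apply Derive_along_ext, E', Up.
Qed.

Lemma Ck_on_pred k (f : V -> R) : Ck_on (S k) U f -> Ck_on k U f.
Proof.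
revert f; induction k as [|k IH]; intros f [H1 H2]; split; trivial.
intros v; destruct (H2 v) as [D C]; split; [exact D|apply IH, C].
Qed.

Lemma Ck_on_const k (c : R) : Ck_on k U (fun _ => c).
Proof.
revert c; induction k as [|k IH]; intros c; (split; [intros p _; apply continuous_const|]).
- exact I.
- intros v; assert (D : forall p : V, is_derive (along (fun _ => c) p v) 0 0).
  { intros p; exact (is_derive_const (K := R_AbsRing) (V := R_NormedModule) c 0). }
  split.
  + intros p _; exists 0; apply D.
  + apply Ck_on_ext with (fun _ => 0); [|apply IH].
    intros p _; symmetry; apply is_derive_unique, D.
Qed.

Lemma Ck_on_linear k (f : V -> R) :
  (forall p, continuous f p) ->
  (forall p v s, f (plus p (scal (RtoC s) v)) = f p + s * f v) ->
  Ck_on k U f.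
Proof.
intros Hc Hl; destruct k as [|k]; (split; [intros p _; apply Hc|]).
- exact I.
- intros v; assert (D : forall p : V, is_derive (along f p v) 0 (f v)).
  { intros p; apply is_derive_ext with (f := fun s => f p + s * f v).
    - intros s; symmetry; apply Hl.
    - auto_derive; [exact I|real_eq; ring]. }
  split.
  + intros p _; exists (f v); apply D.
  + apply Ck_on_ext with (fun _ => f v); [|apply Ck_on_const].
    intros p _; symmetry; apply is_derive_unique, D.
Qed.

Lemma Ck_on_plus k (f g : V -> R) :
  Ck_on k U f -> Ck_on k U g -> Ck_on k U (fun p => f p + g p).
Proof.
revert f g; induction k as [|k IH]; intros f g [F1 F2] [G1 G2]; split.
1, 3: intros p Up; exact (continuous_plus (V := R_NormedModule) f g p (F1 p Up) (G1 p Up)).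
- exact I.
- intros v; destruct (F2 v) as [DF CF]; destruct (G2 v) as [DG CG].
  assert (D : forall p, U p -> is_derive (along (fun p => f p + g p) p v) 0
    (Derive (along f p v) 0 + Derive (along g p v) 0)).
  { intros p Up; exact (is_derive_plus (V := R_NormedModule) _ _ _ _ _
      (Derive_correct _ _ (DF p Up)) (Derive_correct _ _ (DG p Up))). }
  split.
  + intros p Up; eexists; apply D, Up.
  + apply Ck_on_ext with (2 := IH _ _ CF CG).
    intros p Up; symmetry; apply is_derive_unique, D, Up.
Qed.

Lemma Ck_on_mult k (f g : V -> R) :
  Ck_on k U f -> Ck_on k U g -> Ck_on k U (fun p => f p * g p).
Proof.
revert f g; induction k as [|k IH]; intros f g F G; assert (F' := F); assert (G' := G);
  destruct F' as [F1 F2]; destruct G' as [G1 G2]; split.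
1, 3: intros p Up; exact (continuous_mult (K := R_AbsRing) f g p (F1 p Up) (G1 p Up)).
- exact I.
- intros v; destruct (F2 v) as [DF CF]; destruct (G2 v) as [DG CG].
  assert (D : forall p, U p -> is_derive (along (fun p => f p * g p) p v) 0
    (Derive (along f p v) 0 * g p + f p * Derive (along g p v) 0)).
  { intros p Up.
    generalize (is_derive_mult (K := R_AbsRing) _ _ _ _ _
      (Derive_correct _ _ (DF p Up)) (Derive_correct _ _ (DG p Up)) Rmult_comm).
    rewrite !along_0; intros X; exact X. }
  split.
  + intros p Up; eexists; apply D, Up.
  + apply Ck_on_ext with (fun p => Derive (along f p v) 0 * g p + f p * Derive (along g p v) 0).
    * intros p Up; symmetry; apply is_derive_unique, D, Up.
    * apply Ck_on_plus; apply IH; trivial; apply Ck_on_pred; assumption.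
Qed.

Lemma Ck_on_inv k (f : V -> R) :
  (forall p, U p -> f p <> 0) -> Ck_on k U f -> Ck_on k U (fun p => / f p).
Proof.
intros f0; revert f f0; induction k as [|k IH]; intros f f0 F; assert (F' := F);
  destruct F' as [F1 F2]; split.
1, 3: intros p Up; exact (continuous_comp f Rinv p (F1 p Up) (continuous_Rinv _ (f0 p Up))).
- exact I.
- intros v; destruct (F2 v) as [DF CF].
  assert (D : forall p, U p -> is_derive (along (fun p => / f p) p v) 0
    (- 1 * Derive (along f p v) 0 * (/ f p * / f p))).
  { intros p Up.
    assert (X : along f p v 0 <> 0) by (rewrite along_0; apply f0, Up).
    assert (Y := is_derive_inv (along f p v) 0 _ (Derive_correct _ _ (DF p Up)) X).
    rewrite along_0 in Y.
    replace (- 1 * Derive (along f p v) 0 * (/ f p * / f p))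
      with (- Derive (along f p v) 0 / f p ^ 2) by (field; apply f0, Up).
    exact Y. }
  split.
  + intros p Up; eexists; apply D, Up.
  + apply Ck_on_ext with (fun p => - 1 * Derive (along f p v) 0 * (/ f p * / f p)).
    * intros p Up; symmetry; apply is_derive_unique, D, Up.
    * assert (I1 : Ck_on k U (fun p => / f p)) by (apply IH; trivial; apply Ck_on_pred, F).
      repeat apply Ck_on_mult; trivial; apply Ck_on_const.
Qed.
End Ck.

(** The rational model (|z1|^2 + Re (z1^2 conj z2)) / (1 - |z2|^2), locally
    biholomorphic to the tube over the light cone. It is spelled out with sums,
    products and one inverse of real coordinates, the operations under which the
    spaces [Ck_on] are closed. *)
Definition lightcone (p : C2) : R :=
  let a := Re (fst p) in let b := Im (fst p) in
  let c := Re (snd p) in let d := Im (snd p) in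
  (a * a + b * b + ((a * a + - 1 * (b * b)) * c + 2 * (a * b) * d))
  * / (1 + - 1 * (c * c + d * d)).

Lemma lightcone_smooth : smooth lightcone.
Proof.
pose (den := fun p : C2 => 1 + - 1 * (Re (snd p) * Re (snd p) + Im (snd p) * Im (snd p))).
assert (C1 : forall p : C2, continuous (fun p : C2 => Re (fst p)) p).
{ intros p; apply (continuous_comp (fun p : C2 => fst p) (fun z : C_UniformSpace => Re z)).
  - apply continuous_fst.
  - apply (continuous_fst (U := R_UniformSpace) (V := R_UniformSpace)). }
assert (C2' : forall p : C2, continuous (fun p : C2 => Im (fst p)) p).
{ intros p; apply (continuous_comp (fun p : C2 => fst p) (fun z : C_UniformSpace => Im z)).
  - apply continuous_fst.
  - apply (continuous_snd (U := R_UniformSpace) (V := R_UniformSpace)). }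
assert (C3' : forall p : C2, continuous (fun p : C2 => Re (snd p)) p).
{ intros p; apply (continuous_comp (fun p : C2 => snd p) (fun z : C_UniformSpace => Re z)).
  - apply continuous_snd.
  - apply (continuous_fst (U := R_UniformSpace) (V := R_UniformSpace)). }
assert (C4 : forall p : C2, continuous (fun p : C2 => Im (snd p)) p).
{ intros p; apply (continuous_comp (fun p : C2 => snd p) (fun z : C_UniformSpace => Im z)).
  - apply continuous_snd.
  - apply (continuous_snd (U := R_UniformSpace) (V := R_UniformSpace)). }
set (U := fun p => den p <> 0).
assert (K : forall U : C2 -> Prop, open U -> forall k,
  Ck_on k U (fun p : C2 => Re (fst p)) /\ Ck_on k U (fun p : C2 => Im (fst p)) /\
  Ck_on k U (fun p : C2 => Re (snd p)) /\ Ck_on k U (fun p : C2 => Im (snd p))).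
{ intros W oW k; repeat split; apply Ck_on_linear; trivial;
  intros [[a b] [c d]] [[a' b'] [c' d']] s; unfold Re, Im; simpl;
  repeat (unfold scal, plus, mult; simpl); ring. }
assert (Kd : forall W : C2 -> Prop, open W -> forall k, Ck_on k W den).
{ intros W oW k; destruct (K W oW k) as (K1 & K2 & K3 & K4); unfold den.
  repeat first [apply Ck_on_plus | apply Ck_on_mult | apply Ck_on_const | assumption]. }
assert (oU : open U).
{ apply (open_comp den (fun x => x <> 0)); [|apply open_neq].
  intros p _; apply (Kd (fun _ => True) open_true 0%nat); exact I. }
exists U; split; [exact oU|split].
- unfold U, den, Re, Im; simpl; lra.
- intros k; destruct (K U oU k) as (K1 & K2 & K3 & K4).
  unfold lightcone; apply Ck_on_mult; trivial.
  + repeat first [apply Ck_on_plus | apply Ck_on_mult | apply Ck_on_const | assumption].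
  + apply (Ck_on_inv U oU k den); [intros p Up; exact Up|apply Kd, oU].
Qed.

Local Open Scope C_scope.

Lemma lightcone_complex (z1 z2 : C) :
  1 - z2 * Cconj z2 <> 0 ->
  RtoC (lightcone (z1, z2)) =
  (z1 * Cconj z1 + / 2 * (z1 * z1 * Cconj z2 + Cconj z1 * Cconj z1 * z2)) / (1 - z2 * Cconj z2).
Proof.
destruct z1 as [a b]; destruct z2 as [c d]; intros H.
assert (E : 1 - (c, d) * Cconj (c, d) = RtoC (1 + - 1 * (c * c + d * d))).
{ apply injective_projections; simpl; ring. }
rewrite E in *.
assert (HD : (1 + - 1 * (c * c + d * d) <> 0)%R) by (intros K; apply H; rewrite K; reflexivity).
unfold lightcone, Re, Im; cbn [fst snd].
rewrite RtoC_mult, RtoC_inv by exact HD.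
unfold Cdiv; f_equal; apply injective_projections; simpl; field.
Qed.

Lemma lightcone_rational : rational lightcone.
Proof.
exists (fun p => fst p * Cconj (fst p)
   + / 2 * (fst p * fst p * Cconj (snd p) + Cconj (fst p) * Cconj (fst p) * snd p)),
 (fun p => 1 + RtoC (- 1) * (snd p * Cconj (snd p))).
split; [|split; [|split]].
- repeat constructor.
- repeat constructor.
- simpl; intros H; apply (f_equal Re) in H; unfold Re in H; simpl in H; lra.
- assert (H2 : (0 < / 2)%R) by lra.
  exists (mkposreal _ H2); intros [z1 [c d]] [_ [Hc Hd]].
  change (Rabs (c - 0) < / 2)%R in Hc; change (Rabs (d - 0) < / 2)%R in Hd.
  rewrite Rminus_0_r in Hc, Hd; apply Rabs_def2 in Hc, Hd.
  cbn [fst snd]; replace (1 + RtoC (- 1) * ((c, d) * Cconj (c, d)))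
    with (1 - (c, d) * Cconj (c, d)) by (apply injective_projections; simpl; ring).
  apply lightcone_complex.
  intros K; apply (f_equal Re) in K; unfold Re in K; simpl in K; nra.
Qed.

Lemma Cconj_RtoC (x : R) : Cconj (RtoC x) = RtoC x.
Proof. unfold Cconj, RtoC; cbn [fst snd]; rewrite Ropp_0; reflexivity. Qed.

Lemma Cinv_neq_0 (z : C) : z <> 0 -> / z <> 0.
Proof.
intros Hz K; apply C1_nz; rewrite <- (Cinv_r z Hz), K; ring.
Qed.

(** The change of variables that straightens the hypersurface. [W] and [s] stand
    for holomorphic functions, [w] and [w1] for the values of 1/R and (1/R)' at
    z2 + conj z2. The first identity turns the denominator 1 - |s/W|^2 into
    a w / |W|^2; the second says that -w1/w differs from conj s / (W w) by the
    holomorphic term W1/W, which a change of z3 absorbs. *)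
Lemma lightcone_pullback (Z W W1 s : C) (w w1 a : R) :
  W <> 0 -> w <> 0%R -> (0 < a)%R ->
  W * Cconj W - s * Cconj s = RtoC (a * w) ->
  W1 * RtoC w - RtoC w1 * W = Cconj s ->
  RtoC (lightcone (Z * (RtoC (sqrt a) * / W), s * / W)) =
  Z * Cconj Z / RtoC w
  + / 2 * (Z * Z * (W1 * / W - RtoC (w1 / w))
           + Cconj (Z * Z * (W1 * / W - RtoC (w1 / w)))).
Proof.
intros HW Hw Ha H1 H2.
assert (HWb : Cconj W <> 0).
{ intros K; apply HW; rewrite <- (Cconj_conj W), K; apply Cconj_RtoC. }
assert (Hw' : RtoC w <> 0) by (intros K; apply Hw; apply RtoC_inj in K; exact K).
assert (Hr : RtoC (sqrt a) <> 0).
{ intros K; apply RtoC_inj in K; generalize (sqrt_lt_R0 a Ha); lra. }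
assert (Hs : RtoC a = RtoC (sqrt a) * RtoC (sqrt a)).
{ rewrite <- RtoC_mult, sqrt_sqrt by lra; reflexivity. }
assert (H3 : s = Cconj W1 * RtoC w - RtoC w1 * Cconj W).
{ rewrite <- (Cconj_conj s), <- H2, Cminus_conj, !Cmult_conj, !Cconj_RtoC; reflexivity. }
assert (E : 1 - s * / W * Cconj (s * / W) =
            RtoC (sqrt a) * RtoC (sqrt a) * RtoC w * / (W * Cconj W)).
{ rewrite <- Hs, <- RtoC_mult, <- H1, Cmult_conj, Cinv_conj by exact HW.
  field; split; assumption. }
rewrite lightcone_complex; rewrite E.
2: { repeat apply Cmult_neq_0; trivial; apply Cinv_neq_0, Cmult_neq_0; assumption. }
rewrite !Cmult_conj, !Cminus_conj, !Cmult_conj, !Cinv_conj by assumption.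
rewrite !Cconj_RtoC, RtoC_div by exact Hw.
rewrite <- H2, H3.
generalize (Cconj Z) (Cconj W1); intros Zb W1b; revert HWb Hr Hw'.
generalize (Cconj W) (RtoC (sqrt a)) (RtoC w) (RtoC w1); intros.
field; repeat split; assumption.
Qed.

(** * The holomorphic part of [t] *)

Local Open Scope R_scope.

Lemma continuous_tube (z : C) : continuous (T := C_UniformSpace) (fun y => 2 * Re y) z.
Proof.
apply (continuous_scal_r (K := R_AbsRing) (V := R_NormedModule) 2 (fun y : C_UniformSpace => Re y)).
apply (continuous_fst (U := R_UniformSpace) (V := R_UniformSpace)).
Qed.

Lemma weakly_C1_minus_tube (u : C -> R) (g g1 : R -> R) (z : C) :
  weakly_C1_at u z -> locally (2 * Re z) (fun x => is_derive g x (g1 x)) ->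
  continuous g1 (2 * Re z) ->
  weakly_C1_at (fun y => u y - g (2 * Re y)) z /\
  px (fun y => u y - g (2 * Re y)) z = px u z - 2 * g1 (2 * Re z) /\
  py (fun y => u y - g (2 * Re y)) z = py u z.
Proof.
intros (Ux & Uy & Uc) Hg Hg1.
apply (continuous_tube z) in Hg.
assert (Dx : locally (T := C_UniformSpace) z (fun y =>
  is_derive (along (V := C_NormedModule) (fun y => u y - g (2 * Re y)) y (RtoC 1)) 0
    (px u y - 2 * g1 (2 * Re y)))).
{ generalize (filter_and _ _ Ux Hg); apply filter_imp; intros y [U1 G1].
  apply (is_derive_minus (V := R_NormedModule)
    (along (V := C_NormedModule) u y (RtoC 1))
    (along (V := C_NormedModule) (fun y => g (2 * Re y)) y (RtoC 1))).
  - apply Derive_correct, U1.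
  - apply (tube_along_x (fun y => g (2 * Re y)) g); [|exact G1].
    apply filter_forall; intros y'; reflexivity. }
assert (Dy : is_derive (along (V := C_NormedModule) (fun y => u y - g (2 * Re y)) z (scal Ci (RtoC 1))) 0
    (py u z)).
{ replace (py u z) with (py u z - 0) by ring.
  apply (is_derive_minus (V := R_NormedModule)
    (along (V := C_NormedModule) u z (scal Ci (RtoC 1)))
    (along (V := C_NormedModule) (fun y => g (2 * Re y)) z (scal Ci (RtoC 1)))).
  - apply Derive_correct, Uy.
  - apply (tube_along_y (fun y => g (2 * Re y)) g).
    apply filter_forall; intros y'; reflexivity. }
split; [split; [|split]|split].
- revert Dx; apply filter_imp; intros y D; eexists; exact D.
- eexists; exact Dy.
- apply (continuous_ext_loc (T := C_UniformSpace) _ (fun y => px u y - 2 * g1 (2 * Re y))).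
  + revert Dx; apply filter_imp; intros y D; symmetry; apply is_derive_unique, D.
  + apply (continuous_minus (V := R_NormedModule) (px u)); [exact Uc|].
    apply (continuous_scal_r (K := R_AbsRing) (V := R_NormedModule) 2 (fun y : C_UniformSpace => g1 (2 * Re y))).
    apply (continuous_comp (fun y : C_UniformSpace => 2 * Re y) g1); [apply continuous_tube|exact Hg1].
- apply is_derive_unique, (locally_singleton _ _ Dx).
- apply is_derive_unique, Dy.
Qed.

Lemma smooth_weakly_C1 (w : C -> R) :
  smooth (V := C_NormedModule) w -> locally (T := C_UniformSpace) (RtoC 0) (weakly_C1_at w).
Proof.
intros (U & oU & U0 & HU).
generalize (oU _ U0); apply filter_imp; intros z Uz.
destruct (HU 1%nat) as [_ H1].
split; [|split].
- apply (locally_open U); [exact oU| |exact Uz].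
  intros q Uq; apply (proj1 (H1 _) q Uq).
- apply (proj1 (H1 _) z Uz).
- exact (proj1 (proj2 (H1 (RtoC 1))) z Uz).
Qed.

(** The equation (log f)'' = f^2 makes f'/(2 f), pulled back by z + conj z, another
    solution of the equation for [t]; the difference of two solutions is holomorphic. *)
Lemma remainder_holomorphic (t : C -> C) (r : C -> R) (f : R -> R) :
  smoothC (V := C_NormedModule) t ->
  near0 C_NormedModule (fun z => dbar t z = RtoC (r z) ^ 2 / 2)%C ->
  near0 C_NormedModule (tube r f) ->
  smoothR f -> locally 0 (fun x => 0 < f x) ->
  locally 0 (fun x => f x * Derive (Derive f) x = Derive f x ^ 2 + f x ^ 4) ->
  holomorphic1 (fun z => t z - RtoC (Derive f (2 * Re z)%R / (2 * f (2 * Re z)%R)))%C.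
Proof.
intros [Hu Hv] Ht Hr Hf Hp Ho; unfold smoothR in Hf; unfold holomorphic1.
apply smooth_weakly_C1 in Hu, Hv.
set (g := fun x => Derive f x / (2 * f x)).
assert (Hg : locally 0 (fun x => is_derive g x (f x ^ 2 / 2) /\ continuous (fun x => f x ^ 2 / 2) x)).
{ generalize (filter_and _ _ Hf (filter_and _ _ Hp Ho)); apply filter_imp.
  intros x (D & P & E).
  assert (D1 : ex_derive f x) by exact (D 1%nat).
  assert (D2 : ex_derive (Derive f) x) by exact (D 2%nat).
  split.
  - unfold g; auto_derive; [repeat split; trivial; lra|].
    eta_Derive; replace (Derive (Derive f) x) with ((Derive f x ^ 2 + f x ^ 4) / f x) by (rewrite <- E; field; lra).
    real_eq; field; lra.
  - apply (ex_derive_continuous (fun x => f x ^ 2 / 2)); auto_derive; exact D1. }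
apply locally_locally in Hg; apply locally_tube in Hg.
generalize (filter_and _ _ Hu (filter_and _ _ Hv (filter_and _ _ Ht (filter_and _ _ Hr Hg)))).
apply filter_imp; intros z (Cu & Cv & T & Rz & G).
destruct (weakly_C1_minus_tube (fun z => Re (t z)) g (fun x => f x ^ 2 / 2) z Cu) as (K1 & K2 & K3).
{ revert G; apply filter_imp; tauto. }
{ exact (proj2 (locally_singleton _ _ G)). }
set (tau := fun z => (Re (t z) - g (2 * Re z), Im (t z)) : C).
exists (px (fun y => Re (tau y)) z, px (fun y => Im (tau y)) z).
apply is_Cderive_ext with tau.
{ intros y; unfold tau, g; apply injective_projections; simpl; unfold Re, Im; ring. }
apply is_Cderive_dbar; [exact K1|exact Cv|].
assert (T1 := f_equal Re T); assert (T2 := f_equal Im T).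
unfold dbar in T1, T2; rewrite Re_dzbar in T1; rewrite Im_dzbar in T2.
change ((px (fun y => Re (t y)) z - py (fun y => Im (t y)) z) / 2 = Re (RtoC (r z) ^ 2 / 2)%C) in T1.
change ((px (fun y => Im (t y)) z + py (fun y => Re (t y)) z) / 2 = Im (RtoC (r z) ^ 2 / 2)%C) in T2.
replace (Re (RtoC (r z) ^ 2 / 2)%C) with (r z ^ 2 / 2) in T1 by (unfold Re; simpl; field).
replace (Im (RtoC (r z) ^ 2 / 2)%C) with 0 in T2 by (unfold Im; simpl; field).
rewrite Rz in T1.
unfold dbar; apply injective_projections.
- change (Re (dzbar (V := C_NormedModule) (RtoC 1) tau z) = 0); rewrite Re_dzbar.
  change ((px (fun y => Re (t y) - g (2 * Re y)) z - py (fun y => Im (t y)) z) / 2 = 0).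
  rewrite K2; lra.
- change (Im (dzbar (V := C_NormedModule) (RtoC 1) tau z) = 0); rewrite Im_dzbar.
  change ((px (fun y => Im (t y)) z + py (fun y => Re (t y) - g (2 * Re y)) z) / 2 = 0).
  rewrite K3; lra.
Qed.

(** * The holomorphic extension of 1/R *)

Local Open Scope C_scope.

(** Polynomial consequences of the addition formulas, with [a], [b] the initial
    data of 1/R and [A], [B] the cosine and sine at z + conj z. The second is the
    Wronskian of [W] and of the solution translated by conj z. *)
Lemma wave_identities (a b k C S Cb Sb A B : C) :
  b * b - k * (a * a) = 1 -> C * C - k * (S * S) = 1 ->
  C * Cb + k * (S * Sb) = A -> S * Cb + C * Sb = B ->
  (a * C + b * S) * (a * Cb + b * Sb) - S * Sb = a * (a * A + b * B) /\
  (b * C + k * a * S) * (a * A + b * B) - (b * A + k * a * B) * (a * C + b * S) = Sb.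
Proof.
intros H1 H2 <- <-; split.
- transitivity (a * (a * (C * Cb + k * (S * Sb)) + b * (S * Cb + C * Sb))
    + (b * b - k * (a * a) - 1) * (S * Sb)); [ring|rewrite H1; ring].
- transitivity ((b * b - k * (a * a)) * (C * C - k * (S * S)) * Sb); [ring|].
  rewrite H1, H2; ring.
Qed.

(** [W] is the holomorphic extension of 1/R and [s] the sine of the same linear
    equation. *)
Lemma polarized_solution (f : R -> R) :
  locally 0%R (fun x => (0 < f x)%R) ->
  locally 0%R (fun x => ex_derive f x /\ ex_derive (Derive f) x) ->
  locally 0%R (fun x => (f x * Derive (Derive f) x = Derive f x ^ 2 + f x ^ 4)%R) ->
  exists (a : R) (W W1 s s1 W2 : C -> C),
    (0 < a)%R /\ W 0 = RtoC a /\ s 0 = 0 /\ s1 0 = 1 /\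
    (forall z, is_Cderive W z (W1 z) /\ is_Cderive W1 z (W2 z) /\ is_Cderive s z (s1 z)) /\
    locally (T := C_UniformSpace) (RtoC 0) (fun z => let x := (2 * Re z)%R in
      W z * Cconj (W z) - s z * Cconj (s z) = RtoC (a * / f x)%R /\
      W1 z * RtoC (/ f x)%R - RtoC (- Derive f x / f x ^ 2)%R * W z = Cconj (s z)).
Proof.
intros Hp Hd Ho.
destruct (liouville_reciprocal f Hp Hd Ho) as (k & a & b & Ha & Hab & Hsol).
destruct (fundamental_exists k) as (c & s & Hcs).
destruct (fundamental_exists (- k)) as (c' & s' & Hcs').
specialize (Hsol c s Hcs).
assert (Hdbl := fundamental_double k c s Hcs).
set (co := cosC k c s c' s'); set (si := sinC c s c' s').
assert (Dc : forall z, is_Cderive co z (RtoC k * si z)) by exact (is_Cderive_cosC k c s c' s' Hcs Hcs').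
assert (Ds : forall z, is_Cderive si z (co z)) by exact (is_Cderive_sinC k c s c' s' Hcs Hcs').
assert (Dcomb : forall (u v : C) z, is_Cderive (fun z => u * co z + v * si z) z
    (v * co z + RtoC k * u * si z)).
{ intros u v z.
  replace (v * co z + RtoC k * u * si z) with
    ((0 * co z + u * (RtoC k * si z)) + (0 * si z + v * co z)) by ring.
  apply is_Cderive_plus; apply is_Cderive_mult; trivial; apply is_Cderive_const. }
exists a, (fun z => RtoC a * co z + RtoC b * si z),
  (fun z => RtoC b * co z + RtoC k * RtoC a * si z), si, co,
  (fun z => RtoC k * RtoC a * co z + RtoC k * RtoC b * si z).
assert (co0 : co 0 = 1) by exact (cosC_0 k c s c' s' Hcs Hcs').
assert (si0 : si 0 = 0) by exact (sinC_0 k c s c' s' Hcs Hcs').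
split; [exact Ha|split; [rewrite co0, si0; ring|split; [exact si0|split; [exact co0|split]]]].
- intros z; split; [apply Dcomb|split; [|apply Ds]]; apply Dcomb.
- apply locally_tube in Hsol.
  assert (Hdbl' : locally (T := C_UniformSpace) (RtoC 0) (fun z =>
     c (2 * Re z) = c (Re z) ^ 2 + k * s (Re z) ^ 2 /\ s (2 * Re z) = 2 * (s (Re z) * c (Re z)))%R).
  { exact (continuous_fst (U := R_UniformSpace) (V := R_UniformSpace) 0%R 0%R _ Hdbl). }
  generalize (filter_and _ _ Hsol Hdbl'); apply filter_imp.
  intros z ([E1 E2] & C2x & S2x).
  cbv zeta; rewrite E1, E2, C2x, S2x; clear E1 E2 C2x S2x.
  destruct (cosC_sinC_conj k c s c' s' Hcs' z) as [E1 E2].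
  assert (P := cosC_sinC_pythagoras k c s c' s' Hcs Hcs' z).
  fold co si in E1, E2, P.
  set (A := (c (Re z) ^ 2 + k * s (Re z) ^ 2)%R) in *.
  set (B := (2 * (s (Re z) * c (Re z)))%R) in *.
  clearbody A B.
  assert (Hab' : RtoC b * RtoC b - RtoC k * (RtoC a * RtoC a) = 1).
  { rewrite <- !RtoC_mult, <- RtoC_minus; f_equal; rewrite <- Hab; ring. }
  destruct (wave_identities _ _ _ _ _ _ _ _ _ Hab' P E1 E2) as [I1 I2].
  split.
  + rewrite Cplus_conj, !Cmult_conj, !Cconj_RtoC, I1, !RtoC_mult, !RtoC_plus, !RtoC_mult.
    reflexivity.
  + rewrite <- I2, !RtoC_plus, !RtoC_mult; reflexivity.
Qed.

(** * The rigid equivalence *)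

Lemma holomorphic_weighted (n : C -> C) (phi : C -> C) (dn : C2 -> C -> C) :
  (forall p : C2, filterdiff (K := C_AbsRing) (U := C2) (V := C_NormedModule)
     (fun q => n (fst q)) (locally p) (fun h => dn p (fst h))) ->
  holomorphic1 phi -> holomorphic (fun p => n (fst p) * phi (snd p)).
Proof.
intros Hn [e He]; exists e; intros p [_ Hp].
destruct (He _ Hp) as [l Hl].
exists (fun h => dn p (fst h) * phi (snd p) + n (fst p) * (snd h * l)).
apply (filterdiff_Cmult (U := C2) (fun q => n (fst q)) (fun q => phi (snd q))); [apply Hn|].
apply filterdiff_comp_snd, Hl.
Qed.

Lemma filterdiff_fst_sqr (p : C2) :
  filterdiff (K := C_AbsRing) (U := C2) (V := C_NormedModule)
    (fun q => fst q * fst q) (locally p) (fun h => fst h * fst p + fst p * fst h).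
Proof.
apply (filterdiff_Cmult (U := C2) (fun q => fst q) (fun q => fst q)); apply filterdiff_fst2.
Qed.

(** The weight z1^2 removes the third component's [eta] from the differential at
    the origin, which is therefore diagonal with entries [b], [c] and 1. *)
Lemma rigid_map_nondegenerate (phi psi eta : C -> C) (b c l1 l2 : C) :
  is_Cderive phi 0 l1 -> phi 0 = b -> b <> 0 ->
  is_Cderive psi 0 c -> c <> 0 -> is_Cderive eta 0 l2 ->
  nondegenerate (rigid_map (fun p => fst p * phi (snd p)) (fun p => psi (snd p))
    (fun p => fst p * fst p * eta (snd p)) 1).
Proof.
intros Hphi phi0 Hb Hpsi Hc Heta.
exists (fun h => ((fst (fst h) * b, snd (fst h) * c), snd h)),
       (fun h => ((fst (fst h) * / b, snd (fst h) * / c), snd h)).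
split; [|split].
2, 3: intros [[z1 z2] z3]; apply injective_projections; [apply injective_projections|reflexivity];
  cbn [fst snd]; complex_eq; field; assumption.
assert (Dlin : filterdiff (K := C_AbsRing) (U := C3) (V := C2) (fun q => fst q)
   (locally (zero : C3)) (fun h => fst h)) by apply filterdiff_linear, is_linear_fst.
assert (Dlin2 : filterdiff (K := C_AbsRing) (U := C3) (V := C_NormedModule) (fun q => snd q)
   (locally (zero : C3)) (fun h => snd h)) by apply filterdiff_linear, is_linear_snd.
assert (D1 : filterdiff (K := C_AbsRing) (U := C2) (V := C_NormedModule)
   (fun p => fst p * phi (snd p)) (locally (zero : C2)) (fun h => fst h * b)).
{ apply filterdiff_ext_lin with (fun h : C2 => fst h * phi 0 + 0 * (snd h * l1)).
  - apply (filterdiff_Cmult (U := C2) (fun q => fst q) (fun q => phi (snd q))).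
    + apply filterdiff_fst2.
    + apply filterdiff_comp_snd, Hphi.
  - intros h; rewrite phi0; complex_eq; ring. }
assert (D2 : filterdiff (K := C_AbsRing) (U := C2) (V := C_NormedModule)
   (fun p => psi (snd p)) (locally (zero : C2)) (fun h => snd h * c)).
{ apply filterdiff_comp_snd, Hpsi. }
assert (D3 : filterdiff (K := C_AbsRing) (U := C2) (V := C_NormedModule)
   (fun p => fst p * fst p * eta (snd p)) (locally (zero : C2)) (fun h => zero)).
{ apply filterdiff_ext_lin with
    (fun h : C2 => (fst h * 0 + 0 * fst h) * eta 0 + 0 * 0 * (snd h * l2)).
  - apply (filterdiff_Cmult (U := C2) (fun q => fst q * fst q) (fun q => eta (snd q))).
    + apply filterdiff_fst_sqr.
    + apply filterdiff_comp_snd, Heta.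
  - intros h; change ((fst h * 0 + 0 * fst h) * eta 0 + 0 * 0 * (snd h * l2) = RtoC 0); ring. }
assert (D12 := filterdiff_pair _ _ _ _ _ D1 D2).
unfold rigid_map.
apply (filterdiff_pair (U := C2) (V := C_NormedModule)
  (fun p : C3 => (fst (fst p) * phi (snd (fst p)), psi (snd (fst p))))
  (fun p : C3 => RtoC 1 * snd p + fst (fst p) * fst (fst p) * eta (snd (fst p)))
  (fun h : C3 => (fst (fst h) * b, snd (fst h) * c)) (fun h : C3 => snd h)).
- exact (filterdiff_comp' (V := C2) (fun q : C3 => fst q) _ _ _ _ Dlin D12).
- assert (D3' := filterdiff_comp' (V := C2) (fun q : C3 => fst q) _ _ _ _ Dlin D3).
  apply filterdiff_ext_lin with (fun h : C3 => plus (snd h) zero).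
  + apply filterdiff_ext with (fun p : C3 => plus (snd p) (fst (fst p) * fst (fst p) * eta (snd (fst p)))).
    { intros p; complex_eq. rewrite Cmult_1_l; reflexivity. }
    exact (filterdiff_plus_fct _ _ _ _ Dlin2 D3').
  + intros h; apply plus_zero_r.
Qed.

Theorem corollary5p7
  (F : C2 -> R) (r : C -> R) (t : C -> C) (Rf : R -> R)
  (F_graph : graphing_function F)
  (F_class : class_C21 F)
  (* (a) *)
  (ha : near0 C2 (fun p => dz1 (Sfun F) p = 0 /\ dzb1 (Sfun F) p = 0))
  (* (b) *)
  (r_smooth : smooth (V := C_NormedModule) r)
  (t_smooth : smoothC (V := C_NormedModule) t)
  (hb : near0 C2 (fun p =>
     RtoC (F p) = RtoC (r (snd p)) * RtoC (Cmod (fst p) ^ 2)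
                  + t (snd p) * fst p ^ 2
                  + Cconj (t (snd p)) * Cconj (fst p) ^ 2))
  (* (c) *)
  (hc : near0 C_NormedModule (fun z => dbar t z = RtoC (r z) ^ 2 / 2))
  (* (d) *)
  (R_smooth : smoothR Rf)
  (R_pos : locally 0%R (fun x => (0 < Rf x)%R))
  (hd : near0 C_NormedModule (fun z => r z = Rf (Re (z + Cconj z)))) :
  exists G : C2 -> R,
    graphing_function G /\ rational G /\ rigidly_equivalent F G.
Proof.
exists lightcone; split; [split|split].
- exact lightcone_smooth.
- unfold lightcone, Re, Im; simpl; ring.
- exact lightcone_rational.
- assert (Htube : near0 C_NormedModule (tube r Rf)).
  { revert hd; apply filter_imp; intros z E; unfold tube; rewrite E; f_equal.
    destruct z as [x y]; unfold Re; simpl; ring. }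
  assert (Hode : locally 0%R (fun x => (Rf x * Derive (Derive Rf) x = Derive Rf x ^ 2 + Rf x ^ 4)%R)).
  { apply (levi_ode F r t Rf); trivial.
    unfold class_C21 in F_class; revert F_class; apply filter_imp; tauto. }
  assert (Hd : locally 0%R (fun x => ex_derive Rf x /\ ex_derive (Derive Rf) x)).
  { unfold smoothR in R_smooth; revert R_smooth; apply filter_imp; intros x D; exact (conj (D 1%nat) (D 2%nat)). }
  assert (Htau := remainder_holomorphic t r Rf t_smooth hc Htube R_smooth R_pos Hode).
  destruct (polarized_solution Rf R_pos Hd Hode)
    as (a & W & W1 & s & s1 & W2 & Ha & HW0 & Hs0 & Hs1 & HD & Hpol).
  set (tau := fun z => t z - RtoC (Derive Rf (2 * Re z)%R / (2 * Rf (2 * Re z)%R))) in Htau.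
  assert (HWn : W 0 <> 0) by (rewrite HW0; intros K; apply RtoC_inj in K; lra).
  assert (HW : holomorphic1 W).
  { unfold holomorphic1; apply filter_forall; intros z; exists (W1 z); apply HD. }
  assert (HW1 : holomorphic1 W1).
  { unfold holomorphic1; apply filter_forall; intros z; exists (W2 z); apply HD. }
  assert (Hs : holomorphic1 s).
  { unfold holomorphic1; apply filter_forall; intros z; exists (s1 z); apply HD. }
  assert (HWi := holomorphic1_inv W HW HWn).
  set (phi := fun z => RtoC (sqrt a) * / W z).
  set (psi := fun z => s z * / W z).
  set (eta := fun z => W1 z * / W z + - RtoC 2 * tau z).
  assert (Hphi : holomorphic1 phi).
  { apply holomorphic1_mult; [apply holomorphic1_const|exact HWi]. }
  assert (Hpsi : holomorphic1 psi) by (apply holomorphic1_mult; assumption).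
  assert (Heta : holomorphic1 eta).
  { apply holomorphic1_plus; apply holomorphic1_mult; trivial; apply holomorphic1_const. }
  (* z1 is divided by W and z2 becomes s/W; z3 absorbs the terms Re (z1^2 H(z2))
     with H holomorphic. *)
  exists (fun p => fst p * phi (snd p)), (fun p => psi (snd p)),
    (fun p => fst p * fst p * eta (snd p)), 1%R.
  repeat match goal with |- _ /\ _ => split end.
  + apply (holomorphic_weighted (fun z => z) phi (fun _ h => h)); [apply filterdiff_fst2|exact Hphi].
  + destruct Hpsi as [e He]; exists e; intros p [_ Hp].
    destruct (He _ Hp) as [l Hl]; eexists; apply filterdiff_comp_snd, Hl.
  + apply (holomorphic_weighted (fun z => z * z) eta (fun p h => h * fst p + fst p * h));
      [apply filterdiff_fst_sqr|exact Heta].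
  + change (0 * phi 0 = 0); ring.
  + change (psi 0 = 0); unfold psi; rewrite Hs0; ring.
  + change (0 * 0 * eta 0 = 0); ring.
  + exact R1_neq_R0.
  + destruct (locally_singleton _ _ Hphi) as [l1 L1].
    destruct (locally_singleton _ _ Heta) as [l2 L2].
    destruct (locally_singleton _ _ HWi) as [l3 L3].
    apply (rigid_map_nondegenerate phi psi eta (phi 0) (s1 0 * / W 0 + s 0 * l3) l1 l2); trivial.
    * apply Cmult_neq_0; [|apply Cinv_neq_0, HWn].
      intros K; apply RtoC_inj in K; generalize (sqrt_lt_R0 a Ha); lra.
    * exact (is_Cderive_mult s (fun z => / W z) 0 (s1 0) l3 (proj2 (proj2 (HD (RtoC 0)))) L3).
    * rewrite Hs1, Hs0, Cmult_1_l, Cmult_0_l, Cplus_0_r; apply Cinv_neq_0, HWn.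
  + assert (H2 : near0 C_NormedModule (fun z => W z <> 0 /\ (0 < Rf (2 * Re z))%R /\ tube r Rf z)).
    { apply filter_and; [apply holomorphic1_near_neq_0; assumption|].
      apply filter_and; [exact (locally_tube (fun x => (0 < Rf x)%R) R_pos)|exact Htube]. }
    destruct (filter_and _ _ H2 Hpol) as [e He].
    destruct hb as [d Hb].
    exists (mkposreal _ (Rmin_pos e d (cond_pos e) (cond_pos d))).
    intros [[z1 z2] z3] [[B1 B2] _] HF.
    assert (Hb' := Hb (z1, z2) (conj (ball_le _ _ _ (Rmin_r e d) _ B1) (ball_le _ _ _ (Rmin_r e d) _ B2))).
    destruct (He z2 (ball_le _ _ _ (Rmin_l e d) _ B2)) as ((Wn & Pf & Tz) & I1 & I2).
    clear B1 B2 Hb He.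
    unfold rigid_hypersurface in *; cbn [fst snd rigid_map] in *.
    apply RtoC_inj.
    unfold rigid_map; cbn [fst snd].
    unfold phi, psi.
    rewrite (lightcone_pullback z1 (W z2) (W1 z2) (s z2) _ _ a Wn (Rinv_neq_0_compat _ (Rgt_not_eq _ _ Pf)) Ha I1 I2).
    rewrite Cmod2_conj, Tz in Hb'.
    set (x := (2 * Re z2)%R) in *.
    assert (E3 : z3 + Cconj z3 = 2 * RtoC (F (z1, z2))).
    { rewrite <- HF, re_alt; field. }
    (* [m] is w'/w = - R'/R at z2 + conj z2. *)
    assert (E4 : - (2) * RtoC (Derive Rf x / (2 * Rf x)) = RtoC (- Derive Rf x / Rf x ^ 2 / / Rf x)).
    { rewrite <- RtoC_opp, <- RtoC_mult; f_equal; field; lra. }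
    set (m := RtoC (- Derive Rf x / Rf x ^ 2 / / Rf x)) in *.
    assert (E5 : eta z2 = W1 z2 * / W z2 - 2 * t z2 - m).
    { rewrite <- E4; unfold eta, tau; fold x; ring. }
    rewrite re_alt, E5.
    transitivity ((z3 + Cconj z3 + z1 * z1 * (W1 z2 * / W z2 - 2 * t z2 - m)
      + Cconj (z1 * z1 * (W1 z2 * / W z2 - 2 * t z2 - m))) / 2).
    { rewrite Cplus_conj, (Cmult_conj 1), Cconj_RtoC; field; exact Wn. }
    rewrite E3, Hb'.
    rewrite !Cmult_conj, !Cminus_conj, !Cmult_conj, !Cconj_RtoC, RtoC_inv by lra.
    field; repeat split; try exact Wn; intros K; apply RtoC_inj in K; lra.
Qed.
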